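(* Let $\lambda\vdash n$ be a self-conjugate partition of $n$, and let $\mathcal P=\mathrm{id}+\sum_{i=1}^{n-2}\big((i,n-1,n)+(i,n,n-1)\big)\in\mathbb C[A_n]$, acting on $\mathbb C[A_n]$ by multiplication on the right. For each $T_\alpha\in\mathrm{UStd}(\lambda)$, write $\alpha=(a_1,\dots,a_n):=(c(T_\alpha,1),\dots,c(T_\alpha,n))$. Each such $T_\alpha$ provides an eigenvalue of $\mathcal P$, given as follows: (1) $2a_n-1$ is an eigenvalue of $\mathcal P$, if $a_n=a_{n-1}+1$. (2) $-(2a_n+1)$ is an eigenvalue of $\mathcal P$, if $a_n=a_{n-1}-1$. (3) $\pm(a_n+a_{n-1})$ are eigenvalues of $\mathcal P$, if $a_n\neq a_{n-1}\pm1$ and $a_{n-1}<a_n$. Moreover, each eigenvalue has multiplicity $|\mathrm{Std}(\lambda)|=d_\lambda^++d_\lambda^-$.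
   Context: $A_n$ is the alternating group on $\{1,\dots,n\}$ and $\mathbb C[A_n]$ its group algebra. Partitions of $n$ are identified with Young diagrams; $\lambda'$ is the conjugate (transposed) partition of $\lambda$, and $\lambda$ is self-conjugate if $\lambda=\lambda'$. $\mathrm{Std}(\lambda)$ is the set of standard Young tableaux of shape $\lambda$ (filled with $1,\dots,n$, entries increasing along rows and down columns). The content of the box in row $i$ and column $j$ is $j-i$, and $c(T,m)$ is the content of the box labelled $m$ in $T$. $\mathrm{UStd}(\lambda)=\{T\in\mathrm{Std}(\lambda): c(T,2)=1\}$ is the set of upper standard Young tableaux of shape $\lambda$. For self-conjugate $\lambda$ there are two corresponding non-isomorphic irreducible representations $D_\lambda^+$ and $D_\lambda^-$ of $A_n$, each with basis indexed by $\mathrm{UStd}(\lambda)$, of dimensions $d_\lambda^+=d_\lambda^-=|\mathrm{UStd}(\lambda)|=\frac12|\mathrm{Std}(\lambda)|$; $D_\lambda^{\pm}$ occurs in the regular representation $\mathbb C[A_n]$ with multiplicity $d_\lambda^{\pm}$. *)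

(* Defs.v *)
From HB Require Import structures.
From mathcomp Require Import all_boot all_order all_algebra all_fingroup.
From mathcomp Require Import all_solvable all_field all_character.
From mathcomp Require Import reals complex.

Set Implicit Arguments.
Unset Strict Implicit.
Unset Printing Implicit Defensive.

Import GRing.Theory.
Local Open Scope ring_scope.

(** Permutations act on 'I_n, so the label m of {1, ..., n} is the ordinal of
    value m - 1; rows and columns of a diagram are also numbered from 0. *)

Section Partitions.
Local Open Scope nat_scope.

Definition is_partition (n : nat) (la : seq nat) : bool :=
  [&& sorted geq la, 0 \notin la & sumn la == n].

Definition conj_part (la : seq nat) : seq nat :=
  mkseq (fun j => count (fun r => j < r) la) (head 0 la).

Definition self_conjugate (la : seq nat) : bool := conj_part la == la.

End Partitions.

Section Tableaux.
Variable n : nat.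

(** A tableau is encoded by the function sending a label to the (row, column)
    of its box. A partition of n has at most n rows and n columns, and an
    injective map from the n labels to the n boxes is a filling. *)
Definition tableau := {ffun 'I_n -> 'I_n * 'I_n}.

Definition Std (la : seq nat) : {set tableau} :=
  [set T : tableau |
    [&& injectiveb T,
        [forall k, (T k).2 < nth 0 la (T k).1],
        [forall k, forall l,
          ((T k).1 == (T l).1) && ((T k).2 < (T l).2) ==> (k < l)] &
        [forall k, forall l,
          ((T k).2 == (T l).2) && ((T k).1 < (T l).1) ==> (k < l)]]%N].

Definition box_content (b : 'I_n * 'I_n) : int := Posz b.2 - Posz b.1.

(** [content T m] is c(T, m) for 1 <= m <= n (here m is the 1-based label);
    for m > n it is 0, so that [UStd] is empty when n <= 1. *)
Definition content (T : tableau) (m : nat) : int :=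
  nth 0 [seq box_content b | b <- codom T] m.-1.

Definition UStd (la : seq nat) : {set tableau} :=
  [set T in Std la | content T 2 == 1].

(** The eigenvalues provided by T: one, a pair of opposite ones (0 being listed
    twice if the sum vanishes), or none. *)
Definition eigenvalues_of (T : tableau) : seq int :=
  let a := content T n in
  let b := content T n.-1 in
  if a == b + 1 then [:: 2 * a - 1]
  else if a == b - 1 then [:: - (2 * a + 1)]
  else if b < a then [:: a + b; - (a + b)]
  else [::].

End Tableaux.

Section Representations.
Variables (F : fieldType) (n : nat).
Implicit Type la : seq nat.

(** The reference tableau of shape la is filled row by row, so that the label
    k lies in row [reshape_index la k] and column [reshape_offset la k]. *)
Definition row_stab la : {set 'S_n} :=
  [set p : 'S_n |
    [forall k, reshape_index la (p k) == reshape_index la k]].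

Definition col_stab la : {set 'S_n} :=
  [set q : 'S_n |
    [forall k, reshape_offset la (q k) == reshape_offset la k]].

Definition young_symmetrizer la : 'rV[F]_(gcard 'Sym_('I_n)) :=
  gring_row (\sum_(p in row_stab la) \sum_(q in col_stab la)
    (-1) ^+ odd_perm q *: regular_repr F 'Sym_('I_n) (p * q)%g).

Definition specht_repr la :=
  submod_repr
    (cyclic_mx_module (regular_repr F 'Sym_('I_n)) (young_symmetrizer la)).

Definition specht_repr_Alt la :=
  subg_repr (specht_repr la) (Alt_subset 'I_n).

(** Dp and Dm are the two non-isomorphic irreducible representations of A_n
    into which the Specht module splits. An index i : sG stands for the
    irreducible representation [irr_repr i], distinct indices giving
    non-isomorphic representations; as a matrix, i is the i-isotypic component
    of the regular representation. *)
Definition alternating_pair (sG : irrType F 'Alt_('I_n)) la (Dp Dm : sG) :=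
  Dp != Dm /\
  mx_rsim (specht_repr_Alt la)
    (dadd_grepr (Representation (irr_repr Dp)) (Representation (irr_repr Dm))).

(** Maps i to j, j to k and k to i. *)
Definition cycle3 (i j k : 'I_n) : 'S_n := (tperm i j * tperm i k)%g.

(** [regular_repr] acts on row vectors by right multiplication. For n >= 2 the
    only j and k in the range are those of the labels n - 1 and n. *)
Definition shuffle_op : 'M[F]_(gcard 'Alt_('I_n)) :=
  1%:M +
  \sum_(i < n | (i.+2 < n)%N)
    \sum_(j < n | j.+2 == n) \sum_(k < n | k.+1 == n)
      (regular_repr F 'Alt_('I_n) (cycle3 i j k) +
       regular_repr F 'Alt_('I_n) (cycle3 i k j)).

End Representations.

(* Main.v *)
(* Put s = (n-1 n) and let X_k be the sum of the transpositions (i k), i < k (the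
   Jucys-Murphy element). Then P = s X_(n-1) + s X_n = (X_(n-1) + X_n) s. So it
   is enough to know the joint spectrum of the X_k on the Specht module, which is
   given by the contents of the standard tableaux, each with multiplicity one.
   To see this, let e be the Young symmetrizer of the tableau S read by rows.
   Garnir relations show that the left X_k multiply e by the contents of S, and
   (dually, for the tableau T read by columns) that some right translate e h is
   multiplied by the contents of T by the right X_k. Intertwiners of adjacent
   labels then give, for all standard tableaux S and T of the same shape, a
   non-zero element of left weight S and right weight T. Different weights make
   these linearly independent, and there are n! of them, so they form a basis of
   the group algebra, and those with left weight S span the Specht module.
   On the alternating group, s exchanges two halves of the Specht module of a
   self-conjugate shape and commutes with P, so that each half carries half of
   the spectrum; transposing tableaux shows that the upper standard tableaux
   carry exactly half of it. *)

Require Import Defs.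
From HB Require Import structures.
From mathcomp Require Import all_boot all_order all_algebra all_fingroup.
From mathcomp Require Import all_solvable all_field all_character.
From mathcomp Require Import reals complex.
From mathcomp Require Import zify ring.

Set Implicit Arguments.
Unset Strict Implicit.
Unset Printing Implicit Defensive.

Import GRing.Theory Num.Theory.
Local Open Scope ring_scope.

(** * Standard tableaux *)

Section StandardTableaux.
Variable n : nat.
Implicit Types (S T : tableau n) (i j k l : 'I_n) (b : 'I_n * 'I_n).

(** Symmetrizers are tractable only for sorted tableaux: sorted by rows for the left weight, by
    columns for the right one. Every other pair is reached by swaps of adjacent labels whose
    contents differ by at least two, which keeps the intertwiners away from zero. In general P does
    not commute with X_(n-1) and X_n, so its eigenvectors are not weight vectors but combinations of
    v and v s, told apart by s and by the sum and the product of these two elements. On the side of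
    A_n no eigenvector is constructed: the spectrum is carried through intertwining matrices as
    ranks of P - x. The degrees of the two halves are not given in advance either; each half and its
    translate by s fill the Specht module, so neither degree is below one half of the dimension, and
    both equal it. A value provided B times by upper tableaux has multiplicity B in each half, and
    each half occurs as often as its degree, whence B |Std| in all. *)

Definition box_le b b' := (b.1 <= b'.1)%N && (b.2 <= b'.2)%N.

(** The shape is not a parameter: it is the image of [T], required to be an order ideal for
    [box_le]. Permuting labels visibly preserves it, and all shapes are handled at once. *)
Definition stdtab T :=
  [&& injectiveb T,
      [forall k, forall b, box_le b (T k) ==> (b \in codom T)] &
      [forall k, forall l, box_le (T k) (T l) ==> (k <= l)%N]].

Lemma stdtabP T :
  reflect [/\ injective T,
              forall k b, box_le b (T k) -> exists l, T l = b &
              forall k l, box_le (T k) (T l) -> (k <= l)%N]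
          (stdtab T).
Proof.
apply: (iffP and3P) => -[].
  move=> /injectiveP injT /forallP dT /forallP mT; split=> //.
    move=> k b bk; have /forallP/(_ b)/implyP/(_ bk)/codomP[l ->] := dT k.
    by exists l.
  by move=> k l; have /forallP/(_ l)/implyP := mT k.
move=> injT dT mT; split; first exact/injectiveP.
  apply/forallP=> k; apply/forallP=> b; apply/implyP=> /dT[l <-].
  exact: codom_f.
by apply/forallP=> k; apply/forallP=> l; apply/implyP/mT.
Qed.

Lemma box_eq b b' : b.1 = b'.1 :> nat -> b.2 = b'.2 :> nat -> b = b'.
Proof. by case: b b' => [x y] [x' y'] /= /val_inj-> /val_inj->. Qed.

(* At the first label where they differ, the two boxes lie on the same diagonal,
   so the upper one of them would already carry a smaller label in both. *)
Lemma stdtab_content_inj S T : stdtab S -> stdtab T ->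
  (forall k, box_content (S k) = box_content (T k)) -> S = T.
Proof.
suff wl S' T' : stdtab S' -> stdtab T' ->
    (forall k, box_content (S' k) = box_content (T' k)) ->
    forall m k, (k < m)%N -> S' k = T' k.
  by move=> sS sT eqc; apply/ffunP=> k; apply: (wl S T sS sT eqc k.+1).
move=> sS sT eqc; elim=> // m IHm k; rewrite ltnS => lekm.
wlog leST : S' T' sS sT eqc IHm / ((S' k).1 <= (T' k).1)%N.
  move=> wl; case: (leqP (S' k).1 (T' k).1) => [|/ltnW] leTS; first exact: wl.
  by apply/esym/wl => // l lm; rewrite IHm.
have [injS _ _] := stdtabP _ sS; have [injT dT mT] := stdtabP _ sT.
have leb : box_le (S' k) (T' k).
  by rewrite /box_le leST /=; move: (eqc k) leST; rewrite /box_content; lia.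
have [l Tl] := dT _ _ leb; have le_lk : (l <= k)%N by apply: mT; rewrite Tl.
case: (ltngtP l k) le_lk => // [lt_lk _|/val_inj eq_lk _]; last by rewrite -Tl eq_lk.
have Sl : S' l = T' l by apply: IHm; apply: leq_trans lekm.
by move: lt_lk; rewrite (injS l k) ?ltnn // Sl.
Qed.

Definition permtab T (g : 'S_n) : tableau n := [ffun k => T (g k)].

Lemma codom_permtab T g : codom (permtab T g) =i codom T.
Proof.
move=> b; apply/codomP/codomP => -[k ->]; first by exists (g k); rewrite ffunE.
by exists ((g^-1)%g k); rewrite ffunE permKV.
Qed.

Lemma stdtab_swap T i j : stdtab T -> j = i.+1 :> nat ->
  ~~ box_le (T i) (T j) -> stdtab (permtab T (tperm i j)).
Proof.
move=> /stdtabP[injT dT mT] ij nle; apply/stdtabP; split.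
- by move=> k l; rewrite !ffunE => /injT/perm_inj.
- move=> k b; rewrite !ffunE => /dT[l <-]; exists (tperm i j l).
  by rewrite ffunE tpermK.
move=> k l; rewrite !ffunE => bkl; have := mT _ _ bkl; move: bkl.
case: tpermP => [->|->|/eqP nki /eqP nkj];
  case: tpermP => [->|->|/eqP nli /eqP nlj] => bkl lkl;
  rewrite ?(negPf nle) // in bkl;
  try (move: nki nkj; rewrite -!val_eqE /=);
  try (move: nli nlj; rewrite -!val_eqE /=); move: lkl; lia.
Qed.

(** The box of [j] lies higher than that of [i], but not weakly to its left since labels increase
    along [box_le]. One row up and one column to the right make a gap of two. *)
Lemma stdtab_row_descent T i j : stdtab T -> j = i.+1 :> nat ->
  ((T j).1 < (T i).1)%N ->
  stdtab (permtab T (tperm i j)) /\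
  (box_content (T i) + 2 <= box_content (T j)).
Proof.
move=> sT ij lt; have [injT dT mT] := stdtabP _ sT; split.
  by apply: stdtab_swap => //; rewrite /box_le negb_and -!ltnNge lt.
have : ~~ box_le (T j) (T i) by apply/negP=> /mT; rewrite ij ltnn.
by rewrite /box_le /box_content; lia.
Qed.

Lemma stdtab_col_descent T i j : stdtab T -> j = i.+1 :> nat ->
  ((T j).2 < (T i).2)%N ->
  stdtab (permtab T (tperm i j)) /\
  (box_content (T j) + 2 <= box_content (T i)).
Proof.
move=> sT ij lt; have [injT dT mT] := stdtabP _ sT; split.
  by apply: stdtab_swap => //; rewrite /box_le negb_and -!ltnNge lt orbT.
have : ~~ box_le (T j) (T i) by apply/negP=> /mT; rewrite ij ltnn.
by rewrite /box_le /box_content; lia.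
Qed.

(** On a common diagonal, the box in the row of [T i] and the column of [T j] would need a label
    strictly between [i] and [j]. *)
Lemma stdtab_consecutive T i j : stdtab T -> j = i.+1 :> nat ->
  box_content (T i) <> box_content (T j).
Proof.
move=> sT ij; have [injT dT mT] := stdtabP _ sT => eqc.
have nle : ~~ box_le (T j) (T i) by apply/negP=> /mT; rewrite ij ltnn.
have lt1 : ((T i).1 < (T j).1)%N.
  by move: nle eqc; rewrite /box_le /box_content; lia.
have lt2 : ((T i).2 < (T j).2)%N by move: lt1 eqc; rewrite /box_content; lia.
have [|l Tl] := dT j ((T i).1, (T j).2).
  by rewrite /box_le /= leqnn andbT ltnW.
have il : (i <= l)%N by apply: mT; rewrite Tl /box_le /= leqnn ltnW.
have lj : (l <= j)%N by apply: mT; rewrite Tl /box_le /= leqnn ltnW.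
have [eq_l|eq_l] : l = i \/ l = j.
- by have [|] : l = i :> nat \/ l = j :> nat by [lia]; move=> /val_inj; auto.
- by move: Tl lt2; rewrite eq_l => ->; rewrite ltnn.
- by move: Tl lt1; rewrite eq_l => ->; rewrite ltnn.
Qed.

Section Sorting.
Variable r : 'I_n * 'I_n -> 'I_n.

Definition tab_sorted T := forall k l, (k <= l)%N -> (r (T k) <= r (T l))%N.

(** Bubble sort as an induction principle: a tableau without a descent between adjacent labels is
    sorted. *)
Lemma tab_sorted_ind (P : tableau n -> Prop) :
  (forall T i j, stdtab T -> j = i.+1 :> nat -> (r (T j) < r (T i))%N ->
     stdtab (permtab T (tperm i j))) ->
  (forall T, stdtab T -> tab_sorted T -> P T) ->
  (forall T i j, stdtab T -> j = i.+1 :> nat -> (r (T j) < r (T i))%N ->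
     P (permtab T (tperm i j)) -> P T) ->
  forall T, stdtab T -> P T.
Proof.
move=> Hs Hsort Hstep T.
(* The potential increases strictly at each swap of a descent. *)
pose pot T := (\sum_(k < n) k * r (T k))%N.
have pot_le T' : (pot T' <= n * (n * n))%N.
  rewrite -{1}[n]card_ord -sum_nat_const; apply: leq_sum => k _.
  by apply: leq_mul; apply: ltnW.
have [m] := ubnP (n * (n * n) - pot T)%N.
elim: m => // m IHm in T *; rewrite ltnS => lem sT.
case: (pickP (fun ij : 'I_n * 'I_n =>
    (ij.2 == ij.1.+1 :> nat) && (r (T ij.2) < r (T ij.1))%N)) => [[i j] /= |no].
  case/andP=> /eqP ij lt; apply: (Hstep T i j) => //.
  apply: IHm; last exact: Hs.
  suff : (pot T < pot (permtab T (tperm i j)))%N.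
    by have := pot_le (permtab T (tperm i j)); lia.
  have nij : j != i by rewrite -val_eqE /= ij; lia.
  rewrite /pot (bigD1 i) //= (bigD1 j) //= [X in (_ < X)%N](bigD1 i) //=.
  rewrite [X in (_ < _ + X)%N](bigD1 j) //= !ffunE tpermL tpermR.
  rewrite (eq_bigr (fun k : 'I_n => k * r (permtab T (tperm i j) k))%N).
    by move: lt; rewrite ij; nia.
  by move=> k /andP[ki kj]; rewrite ffunE tpermD // eq_sym.
apply: Hsort => // k l; move: {2}(l - k)%N (erefl (l - k)%N) => d.
elim: d k => [|d IHd] k kl lekl.
  by have -> : k = l by apply: val_inj => /=; lia.
have ltkn : (k.+1 < n)%N by have := ltn_ord l; lia.
have := no (k, Ordinal ltkn); rewrite /= eqxx /= => /negbT; rewrite -leqNgt.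
by move=> ler; apply: (leq_trans ler); apply: IHd => /=; lia.
Qed.

End Sorting.

Definition row_sorted := tab_sorted (@fst 'I_n 'I_n).
Definition col_sorted := tab_sorted (@snd 'I_n 'I_n).

Lemma row_sorted_ind (P : tableau n -> Prop) :
  (forall T, stdtab T -> row_sorted T -> P T) ->
  (forall T i j, stdtab T -> j = i.+1 :> nat -> ((T j).1 < (T i).1)%N ->
     P (permtab T (tperm i j)) -> P T) ->
  forall T, stdtab T -> P T.
Proof.
by apply: tab_sorted_ind => T i j sT ij /(stdtab_row_descent sT ij)[].
Qed.

Lemma col_sorted_ind (P : tableau n -> Prop) :
  (forall T, stdtab T -> col_sorted T -> P T) ->
  (forall T i j, stdtab T -> j = i.+1 :> nat -> ((T j).2 < (T i).2)%N ->
     P (permtab T (tperm i j)) -> P T) ->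
  forall T, stdtab T -> P T.
Proof.
by apply: tab_sorted_ind => T i j sT ij /(stdtab_col_descent sT ij)[].
Qed.

(** At the first difference [k], each of the two boxes has a label at least [k] in the other
    tableau, so sortedness puts both in the same row. The left one, say [S k], then has a label at
    most [k] in [T]. *)
Lemma row_sorted_uniq S T : stdtab S -> stdtab T -> codom S =i codom T ->
  row_sorted S -> row_sorted T -> S = T.
Proof.
move=> sS sT eqST rS rT.
suff H m k : (k < m)%N -> S k = T k by apply/ffunP=> k; apply: (H k.+1).
elim: m k => // m IHm k; rewrite ltnS => lekm.
wlog leST : S T sS sT eqST rS rT IHm / ((S k).2 <= (T k).2)%N.
  move=> wl; case: (leqP (S k).2 (T k).2) => [|/ltnW] leTS; first exact: wl.
  by apply/esym/wl => // l lm; rewrite IHm.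
have [injS _ _] := stdtabP _ sS; have [injT dT mT] := stdtabP _ sT.
have /codomP[l Tl] : S k \in codom T by rewrite -eqST codom_f.
have /codomP[l' Sl'] : T k \in codom S by rewrite eqST codom_f.
have lekl : (k <= l)%N.
  rewrite leqNgt; apply/negP=> ltlk.
  have /injS eq_lk : S l = S k by rewrite IHm ?Tl //; apply: leq_trans lekm.
  by rewrite eq_lk ltnn in ltlk.
have lekl' : (k <= l')%N.
  rewrite leqNgt; apply/negP=> ltlk.
  have /injT eq_lk : T l' = T k by rewrite -IHm -?Sl' //; apply: leq_trans lekm.
  by rewrite eq_lk ltnn in ltlk.
have le1 := rT _ _ lekl; have le2 := rS _ _ lekl'.
have lb : box_le (T l) (T k).
  by rewrite /box_le -Tl leST andbT -Sl' in le2 *.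
have lelk := mT _ _ lb.
by rewrite Tl; congr (T _); apply: val_inj => /=; lia.
Qed.

Lemma row_sorted_lt T : stdtab T -> row_sorted T -> forall i k,
  (i < k)%N = ((T i).1 < (T k).1)%N || (((T i).1 == (T k).1) && ((T i).2 < (T k).2)%N).
Proof.
move=> sT rT i k; have [injT dT mT] := stdtabP _ sT.
have [lt|le] := ltnP i k.
  have := rT _ _ (ltnW lt); rewrite leq_eqVlt => /orP[/eqP/val_inj eq1|-> //].
  rewrite eq1 eqxx /= ltnn /=; apply/esym; rewrite ltnNge; apply/negP => le2.
  have /mT : box_le (T k) (T i) by rewrite /box_le eq1 leqnn.
  by rewrite leqNgt lt.
apply/esym/negbTE; rewrite negb_or -leqNgt rT //= negb_and.
case: eqP => //= eq1; rewrite -leqNgt leqNgt; apply/negP => lt2.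
have /mT leik : box_le (T i) (T k) by rewrite /box_le eq1 leqnn ltnW.
have /injT eqik : T i = T k.
  by congr (T _); apply: val_inj; apply/eqP; rewrite eqn_leq leik.
by rewrite eqik ltnn in lt2.
Qed.

Lemma card_left T k : stdtab T ->
  #|[pred i | ((T i).1 == (T k).1) && ((T i).2 < (T k).2)%N]| = (T k).2.
Proof.
move=> sT; have [injT dT mT] := stdtabP _ sT.
transitivity #|[pred c : 'I_n | (c < (T k).2)%N]|; last first.
  rewrite -sum1_card (eq_bigl (fun c : 'I_n => (c < (T k).2)%N)) //.
  rewrite (big_ord_narrow (F := fun _ => 1%N)) 1?ltnW //.
  by rewrite sum1_card card_ord.
set D := [pred i | _].
rewrite -[LHS](@card_in_image _ _ (fun i => (T i).2) D); last first.
  move=> i j; rewrite !inE => /andP[/eqP ri _] /andP[/eqP rj _] eq2.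
  by apply: injT; rewrite [T i]surjective_pairing [T j]surjective_pairing ri rj eq2.
apply: eq_card => c; apply/imageP/idP => [[x]|]; rewrite inE.
  by case/andP=> _ lt ->.
move=> lt; have [|l Tl] := dT k ((T k).1, c); first by rewrite /box_le leqnn ltnW.
by exists l; rewrite ?inE Tl //= eqxx.
Qed.

Definition trtab T : tableau n := [ffun k => ((T k).2, (T k).1)].

Lemma trtabK : involutive trtab.
Proof. by move=> T; apply/ffunP=> k; rewrite !ffunE /= -surjective_pairing. Qed.

Lemma trtab_content T k : box_content (trtab T k) = - box_content (T k).
Proof. by rewrite ffunE /box_content opprB. Qed.

Lemma stdtab_tr T : stdtab T -> stdtab (trtab T).
Proof.
move=> /stdtabP[injT dT mT]; apply/stdtabP; split.
- move=> k l; rewrite !ffunE => -[eq2 eq1]; apply: injT.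
  by rewrite [T k]surjective_pairing [T l]surjective_pairing eq1 eq2.
- move=> k [b1 b2]; rewrite !ffunE /box_le /= andbC => /(dT k (b2, b1))[l Tl].
  by exists l; rewrite ffunE Tl.
by move=> k l; rewrite !ffunE /box_le andbC => /mT.
Qed.

Lemma same_diagram_perm S T : stdtab S -> stdtab T -> codom S =i codom T ->
  exists h : 'S_n, T = permtab S h.
Proof.
move=> /stdtabP[injS _ _] /stdtabP[injT _ _] eqST.
have ex k : {l | S l == T k}.
  apply: sigW; have /codomP[l ->] : T k \in codom S by rewrite eqST codom_f.
  by exists l.
have inj_f : injective (fun k => sval (ex k)).
  by move=> k l eq; apply: injT; rewrite -(eqP (svalP (ex k))) -(eqP (svalP (ex l))) eq.
by exists (perm inj_f); apply/ffunP=> k; rewrite !ffunE permE (eqP (svalP (ex k))).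
Qed.

End StandardTableaux.

(** * Jucys-Murphy elements and their intertwiners *)

Section GroupAlgebra.
Variables (F : numFieldType) (n : nat).
Implicit Types (S T : tableau n) (i j k l : 'I_n) (g h p q s t : 'S_n).

Local Notation N := (gcard 'Sym_('I_n)).
Local Notation rho := (regular_repr F 'Sym_('I_n)).

Definition gdelta g : 'rV[F]_N := delta_mx 0 (gring_index 'Sym_('I_n) g).

Definition glift (f : 'S_n -> 'rV[F]_N) : 'M[F]_N :=
  \matrix_(i < N) f (enum_val i).

Lemma gdelta_glift f g : gdelta g *m glift f = f g.
Proof. by rewrite -rowE rowK gring_indexK ?inE. Qed.

Lemma gdelta_ext (A B : 'M[F]_N) :
  (forall g, gdelta g *m A = gdelta g *m B) -> A = B.
Proof.
move=> eqAB; apply/row_matrixP=> i; rewrite !rowE.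
by have := eqAB (enum_val i); rewrite /gdelta gring_valK.
Qed.

Lemma gdelta_regular g h : gdelta g *m rho h = gdelta (g * h)%g.
Proof. by rewrite -rowE rowK gring_indexK ?inE. Qed.

Lemma gring_row_regular g : gring_row (rho g) = gdelta g.
Proof. by rewrite /gring_row rowK gring_indexK ?inE ?mul1g. Qed.

Definition lmul h : 'M[F]_N := glift (fun g => gdelta (h * g)%g).

Lemma gdelta_lmul g h : gdelta g *m lmul h = gdelta (h * g)%g.
Proof. exact: gdelta_glift. Qed.

Lemma lmul1 : lmul 1%g = 1%:M.
Proof. by apply: gdelta_ext => g; rewrite gdelta_lmul mul1g mulmx1. Qed.

Lemma lmulM g h : lmul g *m lmul h = lmul (h * g)%g.
Proof. by apply: gdelta_ext => x; rewrite mulmxA !gdelta_lmul mulgA. Qed.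

Lemma lmul_regular g h : lmul g *m rho h = rho h *m lmul g.
Proof.
by apply: gdelta_ext => x; rewrite !mulmxA gdelta_lmul !gdelta_regular gdelta_lmul mulgA.
Qed.

(* Left and right multiplication are only used through the following property,
   which does not distinguish representations from antirepresentations. *)
Definition palindromic (m : nat) (a : 'S_n -> 'M[F]_m) :=
  a 1%g = 1%:M /\ forall s t, a s *m a t *m a s = a (s * t * s)%g.

Lemma lmul_palindromic : palindromic lmul.
Proof. by split=> [|s t]; rewrite ?lmul1 // !lmulM !mulgA. Qed.

Lemma repr_palindromic m (rG : mx_representation F 'Sym_('I_n) m) :
  palindromic rG.
Proof. by split=> [|s t]; rewrite ?repr_mx1 // -!repr_mxM ?inE. Qed.

Section JucysMurphy.
Variables (m : nat) (a : 'S_n -> 'M[F]_m).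
Hypothesis pal_a : palindromic a.

Definition jm k : 'M[F]_m := \sum_(l < n | (l < k)%N) a (tperm l k).

Definition jm_weight T (v : 'rV[F]_m) :=
  forall k, v *m jm k = (box_content (T k))%:~R *: v.

Lemma pal_tpermK i j : a (tperm i j) *m a (tperm i j) = 1%:M.
Proof.
have [a1 palM] := pal_a.
by have := palM (tperm i j) 1%g; rewrite a1 mulmx1 mulg1 tperm2 a1.
Qed.

Lemma pal_tpermJ i j k l :
  a (tperm i j) *m a (tperm k l) *m a (tperm i j) =
  a (tperm (tperm i j k) (tperm i j l)).
Proof. by have [_ ->] := pal_a; rewrite -tpermJ conjgE tpermV mulgA. Qed.

Lemma jm_swap i j : j = i.+1 :> nat ->
  a (tperm i j) *m jm i *m a (tperm i j) = jm j - a (tperm i j).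
Proof.
move=> ij; rewrite /jm mulmx_sumr mulmx_suml.
rewrite [in RHS](bigD1 i) ?ij //= [RHS]addrC addKr.
apply: eq_big => [l|l ltli]; first by rewrite -val_eqE /=; lia.
by rewrite pal_tpermJ tpermL tpermD // -val_eqE /=; lia.
Qed.

Lemma jm_swap_other i j k : j = i.+1 :> nat -> k != i -> k != j ->
  a (tperm i j) *m jm k = jm k *m a (tperm i j).
Proof.
move=> ij ki kj; rewrite -[RHS]mul1mx -(pal_tpermK i j) -mulmxA; congr (_ *m _).
rewrite mulmxA /jm mulmx_sumr mulmx_suml (reindex_inj (@perm_inj _ (tperm i j))).
apply: eq_big => [l|l ltlk]; last first.
  by rewrite pal_tpermJ (tpermD (z := k)) // eq_sym.
by move: ki kj; case: tpermP => [->|->|]; rewrite -!val_eqE //=; lia.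
Qed.

(** With [jm_mul_swap'], these are the relations of the degenerate affine Hecke algebra. They make
    the span of a weight vector and its image under the transposition stable under [jm i] and
    [jm j]. *)
Lemma jm_mul_swap i j : j = i.+1 :> nat ->
  a (tperm i j) *m jm i = jm j *m a (tperm i j) - 1%:M.
Proof.
move=> ij; rewrite -[LHS]mulmx1 -(pal_tpermK i j) mulmxA jm_swap //.
by rewrite mulmxBl pal_tpermK.
Qed.

Lemma jm_mul_swap' i j : j = i.+1 :> nat ->
  a (tperm i j) *m jm j = jm i *m a (tperm i j) + 1%:M.
Proof.
move=> ij; have /(canRL (subrK _)) -> := esym (jm_swap ij).
by rewrite mulmxDr -!mulmxA mulmxA pal_tpermK mul1mx.
Qed.

(** On the span of [v] and its image under the transposition, [jm i] is triangular with the contents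
    of [i] and [j] as eigenvalues; subtracting [v / d] yields the eigenvector for the content of
    [j]. *)
Lemma jm_intertwine T (v : 'rV[F]_m) i j (d := box_content (T j) - box_content (T i)) :
  j = i.+1 :> nat -> d != 0 -> jm_weight T v ->
  jm_weight (permtab T (tperm i j)) (v *m a (tperm i j) - (d%:~R)^-1 *: v).
Proof.
move=> ij d0 wv k; have dF : (d%:~R : F) != 0 by rewrite intr_eq0.
have d_def : (d%:~R : F) = (box_content (T j))%:~R - (box_content (T i))%:~R.
  by rewrite -rmorphB.
rewrite mulmxBl -mulmxA -scalemxAl wv ffunE.
case: tpermP => [->|->|/eqP nki /eqP nkj].
- rewrite jm_mul_swap // mulmxBr mulmxA wv mulmx1 -scalemxAl scalerBr.
  rewrite -addrA; congr (_ + _); rewrite !scalerA -opprD -[X in X + _]scale1r -scalerDl.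
  by congr (- (_ *: _)); rewrite d_def; field; rewrite -d_def.
- rewrite jm_mul_swap' // mulmxDr mulmxA wv mulmx1 -scalemxAl scalerBr.
  rewrite -addrA; congr (_ + _); rewrite !scalerA -[X in X - _]scale1r -scalerBl -scaleNr.
  by congr (_ *: _); rewrite d_def; field; rewrite -d_def.
rewrite jm_swap_other // mulmxA wv -scalemxAl scalerBr !scalerA.
by rewrite [X in _ - X *: _]mulrC.
Qed.

(** Otherwise [v] would be an eigenvector of an involution for the eigenvalue [1 / d]. *)
Lemma jm_intertwine_neq0 (v : 'rV[F]_m) i j (d : int) :
  v != 0 -> d ^+ 2 != 1 -> d != 0 ->
  v *m a (tperm i j) - (d%:~R)^-1 *: v != 0.
Proof.
move=> v0 d1 d0; rewrite subr_eq0; apply: contra d1 => /eqP eqv.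
have : v *m a (tperm i j) *m a (tperm i j) = v.
  by rewrite -mulmxA pal_tpermK mulmx1.
rewrite eqv -scalemxAl eqv scalerA => /eqP.
rewrite -subr_eq0 -[X in _ - X]scale1r -scalerBl scaler_eq0 (negPf v0) orbF.
rewrite subr_eq0 -invfM -[X in _ == X]invr1 => /eqP/invr_inj/eqP.
by rewrite -intrM -[1]/(1%:~R) eqr_int.
Qed.

End JucysMurphy.

End GroupAlgebra.

(** * Young symmetrizers and Garnir relations *)

Section YoungSymmetrizer.
Variables (F : numFieldType) (n : nat).
Implicit Types (S T : tableau n) (i j k l : 'I_n) (g h p q s t : 'S_n).

Local Notation N := (gcard 'Sym_('I_n)).
Local Notation rho := (regular_repr F 'Sym_('I_n)).
Local Notation delta := (@gdelta F n).
Local Notation lmul := (@lmul F n).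

Definition rowst T : {set 'S_n} :=
  [set p : 'S_n | [forall k, (T (p k)).1 == (T k).1]].

Definition colst T : {set 'S_n} :=
  [set q : 'S_n | [forall k, (T (q k)).2 == (T k).2]].

Definition ysym T : 'rV[F]_N :=
  \sum_(p in rowst T) \sum_(q in colst T) (-1) ^+ odd_perm q *: delta (p * q)%g.

Lemma rowstP T p : reflect (forall k, (T (p k)).1 = (T k).1) (p \in rowst T).
Proof. by rewrite inE; apply: (iffP forallP) => eqT k; apply/eqP. Qed.

Lemma colstP T q : reflect (forall k, (T (q k)).2 = (T k).2) (q \in colst T).
Proof. by rewrite inE; apply: (iffP forallP) => eqT k; apply/eqP. Qed.

Lemma rowst_mull T h p : h \in rowst T -> ((h * p)%g \in rowst T) = (p \in rowst T).
Proof.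
move=> /rowstP hR; apply/rowstP/rowstP => pR k; last by rewrite permM pR.
by have := pR ((h^-1)%g k); rewrite permM permKV -(hR ((h^-1)%g k)) permKV.
Qed.

Lemma colst_mull T h p : h \in colst T -> ((h * p)%g \in colst T) = (p \in colst T).
Proof.
move=> /colstP hR; apply/colstP/colstP => pR k; last by rewrite permM pR.
by have := pR ((h^-1)%g k); rewrite permM permKV -(hR ((h^-1)%g k)) permKV.
Qed.

Lemma ysym_lmul T h : ysym T *m lmul h =
  \sum_(p in rowst T) \sum_(q in colst T)
     (-1) ^+ odd_perm q *: delta (h * p * q)%g.
Proof.
rewrite mulmx_suml; apply: eq_bigr => p _; rewrite mulmx_suml.
by apply: eq_bigr => q _; rewrite -scalemxAl gdelta_lmul mulgA.
Qed.

Lemma ysym_lmul_row T h : h \in rowst T -> ysym T *m lmul h = ysym T.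
Proof.
move=> hR; rewrite ysym_lmul /ysym [RHS](reindex_inj (mulgI h)) /=.
by apply: eq_bigl => p; rewrite rowst_mull.
Qed.

Lemma gdelta_coef g : delta g 0 (gring_index 'Sym_('I_n) 1%g) = (g == 1%g)%:R.
Proof.
by rewrite mxE eqxx /= -(inj_eq (can_inj gring_valK)) !gring_indexK ?inE // eq_sym.
Qed.

(** The coefficient of the identity is one, since the row and column stabilisers of an injective
    filling meet trivially. *)
Lemma ysym_neq0 T : injective T -> ysym T != 0.
Proof.
move=> injT; apply/eqP=> /matrixP/(_ 0 (gring_index 'Sym_('I_n) 1%g))/eqP.
have R1 : 1%g \in rowst T by apply/rowstP=> k; rewrite perm1.
have C1 : 1%g \in colst T by apply/colstP=> k; rewrite perm1.
have cap p : p \in rowst T -> p \in colst T -> p = 1%g.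
  move=> /rowstP pR /colstP pC; apply/permP=> k; rewrite perm1; apply: injT.
  by apply: box_eq; rewrite ?pR ?pC.
rewrite summxE (bigD1 1%g) //= summxE (bigD1 1%g) //= mxE gdelta_coef mulg1 eqxx.
rewrite odd_perm1 mul1r big1 ?addr0 => [|q /andP[_ q1]]; last first.
  by rewrite mxE gdelta_coef mul1g (negPf q1) mulr0.
rewrite big1 ?addr0 ?mxE ?oner_eq0 // => p /andP[pR p1].
rewrite summxE big1 // => q qC; rewrite mxE gdelta_coef.
case: eqP => [pq1|]; last by rewrite mulr0.
case/eqP: p1; apply: cap => //.
have -> : p = (q^-1)%g by apply/eqP; rewrite eq_mulgV1 invgK pq1.
apply/colstP=> k; have /colstP qC' := qC.
by rewrite -[in RHS](permKV q k) qC'.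
Qed.

Section Garnir.
Variables (T : tableau n) (k r : 'I_n).
Hypotheses (sT : stdtab T) (ltr : (r < (T k).1)%N).

Let A : {set 'I_n} := [set i | (T i).1 == r].
Let H : {set 'S_n} := [set h | perm_on (k |: A) h].

Let kNA : k \notin A.
Proof. by rewrite inE -val_eqE /= neq_ltn ltr orbT. Qed.

Let tperm_H i : i \in k |: A -> tperm i k \in H.
Proof.
move=> iA; rewrite inE; apply: (subset_trans (tperm_on i k)).
by apply/subsetP=> x /set2P[] ->; rewrite // !inE eqxx.
Qed.

(* The row r meets the column of p k, so that some transposition of k with a
   label of A is moved by p to an element of the column stabiliser: it changes
   the sign of the sum but only permutes H. *)
Let garnir_inner p : p \in rowst T ->
  \sum_(h in H) \sum_(q in colst T) (-1) ^+ odd_perm q *: delta (h * p * q)%g = 0.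
Proof.
move=> pR; have /rowstP pRP := pR; have [injT dT mT] := stdtabP _ sT.
have [l Tl] : exists l, T l = (r, (T (p k)).2).
  by apply: (dT (p k)); rewrite /box_le /= pRP ltnW /=.
have [x pxl] : exists x, p x = l by exists ((p^-1)%g l); rewrite permKV.
have xA : x \in A by rewrite inE -pRP pxl Tl.
have xk : x != k by apply: contraNneq kNA => <-.
pose t := tperm x k; pose tau := (t ^ p)%g.
have tH : t \in H by apply: tperm_H; rewrite inE xA orbT.
have tauC : tau \in colst T.
  apply/colstP=> y; rewrite /tau tpermJ pxl.
  by case: tpermP => [->|->|]; rewrite // Tl.
set Z := LHS.
have : Z = - Z.
  rewrite {1}/Z (reindex_inj (mulIg t)) /= -sumrN.
  apply: eq_big => [h|h hH].
    by rewrite inE; move: tH; rewrite [in X in X -> _]inE => tH; rewrite [RHS]inE;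
       apply/idP/idP => [hH|hH]; [rewrite -(mulgK t h) /t tpermV|]; apply: perm_onM.
  rewrite -sumrN [RHS](reindex_inj (mulgI tau)) /=.
  apply: eq_big => [q|q _]; first by rewrite colst_mull.
  rewrite -scaleNr odd_permM odd_permJ odd_tperm xk /= signrN; congr (_ *: delta _).
    by rewrite opprK.
  by rewrite /tau conjgE !mulgA mulgK.
by move/eqP; rewrite -subr_eq0 opprK -mulr2n -scaler_nat scaler_eq0 pnatr_eq0 /= => /eqP.
Qed.

Let garnir_sym0 : \sum_(h in H) ysym T *m lmul h = 0.
Proof.
under eq_bigr => h _ do rewrite ysym_lmul.
by rewrite exchange_big big1 // => p pR; apply: garnir_inner.
Qed.

Let Y := \sum_(i in k |: A) ysym T *m lmul (tperm i k).

(** The transpositions with [k], and the identity for [i = k], represent the cosets in [H] of the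
    permutations of the row [r]. As the latter fix [ysym T], an element of [H] merely permutes the
    terms of [Y]. *)
Let Y_fix h : h \in H -> Y *m lmul h = Y.
Proof.
rewrite inE => hH; have hVH := perm_onV hH.
have stab i : i \in k |: A -> h i \in k |: A by rewrite perm_closed.
rewrite mulmx_suml [RHS](reindex_inj (@perm_inj _ (h^-1)%g)) /=.
apply: eq_big => [i|i iA]; first by rewrite perm_closed.
pose h' := (tperm ((h^-1)%g i) k * h * tperm i k)%g.
have h'R : h' \in rowst T.
  apply/rowstP=> j.
  have h'H : perm_on (k |: A) h'.
    have iA' : (h^-1)%g i \in k |: A by rewrite perm_closed.
    have := tperm_H iA'; have := tperm_H iA; rewrite !inE => tH tH'.
    by apply: perm_onM => //; apply: perm_onM.
  have h'k : h' k = k by rewrite !permM tpermR permKV tpermL.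
  have [->|jk] := eqVneq j k; first by rewrite h'k.
  have [jA|jA] := boolP (j \in k |: A); last first.
    by rewrite (out_perm h'H).
  have : h' j \in k |: A by rewrite perm_closed.
  have : h' j != k by rewrite -[X in _ != X]h'k (inj_eq perm_inj).
  by move: jA; rewrite !inE (negPf jk) => /= /eqP-> /negPf-> /eqP->.
by rewrite -[in RHS](ysym_lmul_row h'R) -!mulmxA !lmulM /h' !mulgA tperm2 mul1g.
Qed.

(* The sum over k |: A is invariant under H, and it is killed by the
   symmetriser of H, hence it vanishes; the index k contributes ysym T. *)
Lemma garnir_row :
  \sum_(i | (T i).1 == r) ysym T *m lmul (tperm i k) = - ysym T.
Proof.
have Y0 : Y = 0.
  have : #|H|%:R *: Y = 0.
    rewrite scaler_nat -sumr_const -(eq_bigr _ (fun h hH => Y_fix hH)).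
    under eq_bigr => h _ do rewrite mulmx_suml.
    rewrite exchange_big big1 //= => i iA.
    rewrite -[RHS]garnir_sym0 [RHS](reindex_inj (mulIg (tperm i k))) /=.
    apply: eq_big => [h|h _]; last by rewrite -mulmxA lmulM.
    have := tperm_H iA; rewrite !inE => tH.
    by apply/idP/idP => [hH|hH]; [|rewrite -(mulgK (tperm i k) h) tpermV];
      apply: perm_onM.
  move/eqP; rewrite scaler_eq0 pnatr_eq0 => /orP[|/eqP //].
  by rewrite cards_eq0 => /eqP/setP/(_ 1%g); rewrite !inE perm_on1.
move: Y0; rewrite /Y big_setU1 //= tperm1 lmul1 mulmx1 => /eqP.
rewrite addrC addr_eq0 => /eqP <-.
by apply: eq_bigl => i; rewrite inE.
Qed.

End Garnir.

(** The labels smaller than [k] are those to its left and those in higher rows. Each one on the left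
    contributes [ysym T], each whole higher row contributes [- ysym T] by the Garnir relation:
    column minus row in total. *)
Lemma ysym_left_weight T : stdtab T -> row_sorted T -> jm_weight lmul T (ysym T).
Proof.
move=> sT rT k; rewrite /jm mulmx_sumr.
rewrite (bigID (fun i => (T i).1 == (T k).1)) /=.
rewrite (eq_bigr (fun=> ysym T)) => [|i /andP[_ /eqP ri]]; last first.
  rewrite ysym_lmul_row //; apply/rowstP=> j.
  by case: tpermP => [->|->|].
rewrite sumr_const.
rewrite (eq_card (B := [pred i | ((T i).1 == (T k).1) && ((T i).2 < (T k).2)%N])); last first.
  move=> i; rewrite unfold_in [RHS]inE (row_sorted_lt sT rT i k).
  by case: eqP => [->|]; rewrite ?andbF ?andbT ?ltnn.
rewrite card_left //.
have -> : \sum_(i < n | (i < k)%N && ((T i).1 != (T k).1)) ysym T *m lmul (tperm i k) =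
    \sum_(r < n | (r < (T k).1)%N) - ysym T.
  rewrite (partition_big (fun i => (T i).1) (fun r : 'I_n => (r < (T k).1)%N)) /=; last first.
    move=> i; rewrite (row_sorted_lt sT rT i k) => /andP[/orP[//|/andP[/eqP->]]].
    by rewrite eqxx.
  apply: eq_bigr => r ltr; rewrite -(garnir_row sT ltr); apply: eq_bigl => i.
  rewrite andbC; case: eqP => [Tr|] //=; rewrite (row_sorted_lt sT rT i k) Tr ltr /=.
  by rewrite -val_eqE neq_ltn ltr.
rewrite sumr_const (_ : #|_| = (T k).1); last first.
  rewrite -sum1_card (big_ord_narrow (F := fun _ => 1%N)) 1?ltnW //.
  by rewrite sum1_card card_ord.
rewrite mulNrn -!scaler_nat -scalerBl; congr (_ *: _).
by rewrite /box_content rmorphB.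
Qed.

(* This antiautomorphism exchanges left and right multiplication, and, up to
   transposition, rows and columns. *)
Definition signed_inv : 'M[F]_N :=
  glift (fun g => (-1) ^+ odd_perm g *: delta (g^-1)%g).

Lemma gdelta_signed_inv g :
  delta g *m signed_inv = (-1) ^+ odd_perm g *: delta (g^-1)%g.
Proof. exact: gdelta_glift. Qed.

Lemma lmul_signed_inv h :
  lmul h *m signed_inv = (-1) ^+ odd_perm h *: (signed_inv *m rho (h^-1)%g).
Proof.
apply: gdelta_ext => g; rewrite mulmxA gdelta_lmul gdelta_signed_inv.
rewrite -scalemxAr mulmxA gdelta_signed_inv -scalemxAl gdelta_regular scalerA.
by rewrite odd_permM signr_addb invMg.
Qed.

Lemma jm_signed_inv k : jm lmul k *m signed_inv = - (signed_inv *m jm rho k).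
Proof.
rewrite /jm mulmx_suml mulmx_sumr -sumrN; apply: eq_bigr => l ltlk.
by rewrite lmul_signed_inv tpermV odd_tperm -val_eqE neq_ltn ltlk scaleN1r.
Qed.

Lemma ysym_signed_inv T : ysym (trtab T) *m signed_inv = ysym T.
Proof.
have eR : rowst (trtab T) = colst T.
  by apply/setP=> p; rewrite !inE; apply: eq_forallb => k; rewrite !ffunE.
have eC : colst (trtab T) = rowst T.
  by apply/setP=> p; rewrite !inE; apply: eq_forallb => k; rewrite !ffunE.
have invR p : ((p^-1)%g \in rowst T) = (p \in rowst T).
  suff impl q : q \in rowst T -> (q^-1)%g \in rowst T.
    by apply/idP/idP => /impl; rewrite ?invgK.
  by move=> /rowstP qR; apply/rowstP=> k; rewrite -[in RHS](permKV q k) qR.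
have invC p : ((p^-1)%g \in colst T) = (p \in colst T).
  suff impl q : q \in colst T -> (q^-1)%g \in colst T.
    by apply/idP/idP => /impl; rewrite ?invgK.
  by move=> /colstP qR; apply/colstP=> k; rewrite -[in RHS](permKV q k) qR.
rewrite /ysym eR eC exchange_big mulmx_suml (reindex_inj invg_inj) /=.
apply: eq_big => // p pR; rewrite mulmx_suml (reindex_inj invg_inj) /=.
apply: eq_big => // q qC; rewrite -scalemxAl gdelta_signed_inv scalerA.
rewrite odd_permM !odd_permV signr_addb mulrCA -signr_addb addbb mulr1.
by rewrite -invMg invgK.
Qed.

Lemma ysym_right_weight T : stdtab T -> col_sorted T -> jm_weight rho T (ysym T).
Proof.
move=> sT cT k; rewrite -ysym_signed_inv.
have rT : row_sorted (trtab T) by move=> i j /cT; rewrite !ffunE.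
have := ysym_left_weight (stdtab_tr sT) rT k => /(congr1 (mulmx^~ signed_inv)).
rewrite -mulmxA jm_signed_inv mulmxN mulmxA -scalemxAl trtab_content rmorphN scaleNr.
exact: oppr_inj.
Qed.

(** One vector is both a right translate of [ysym S] and a left translate of another symmetrizer. It
    inherits its left weight from the former and its right weight from the latter. *)
Lemma ysym_permtab S h :
  ysym S *m rho (h^-1)%g = ysym (permtab S h) *m lmul (h^-1)%g.
Proof.
rewrite ysym_lmul /ysym mulmx_suml (reindex_inj (conjg_inj h)) /=.
apply: eq_big => [p|p _].
  apply/rowstP/rowstP => pR k.
    by have := pR (h k); rewrite !ffunE permJ.
  by have := pR ((h^-1)%g k); rewrite !ffunE permKV => <-; rewrite -permJ permKV.
rewrite mulmx_suml (reindex_inj (conjg_inj h)) /=.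
apply: eq_big => [q|q _].
  apply/colstP/colstP => qC k.
    by have := qC (h k); rewrite !ffunE permJ.
  by have := qC ((h^-1)%g k); rewrite !ffunE permKV => <-; rewrite -permJ permKV.
rewrite -scalemxAl gdelta_regular odd_permJ -conjMg conjgE !mulgA.
by rewrite mulgK.
Qed.

Lemma jm_weight_mulr (a : 'S_n -> 'M[F]_N) T v B :
  (forall k, B *m jm a k = jm a k *m B) ->
  jm_weight a T v -> jm_weight a T (v *m B).
Proof. by move=> comB wv k; rewrite -mulmxA comB mulmxA wv -scalemxAl. Qed.

Lemma regular_jm_lmul h k : rho h *m jm lmul k = jm lmul k *m rho h.
Proof.
by rewrite /jm mulmx_sumr mulmx_suml; apply: eq_bigr => i _; rewrite lmul_regular.
Qed.

Lemma lmul_jm_regular h k : lmul h *m jm rho k = jm rho k *m lmul h.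
Proof.
by rewrite /jm mulmx_sumr mulmx_suml; apply: eq_bigr => i _; rewrite lmul_regular.
Qed.

End YoungSymmetrizer.

(** * Counting pairs of standard tableaux *)

Section LatticeWords.
Local Open Scope nat_scope.
Variable m : nat.
Local Notation shape := {ffun 'I_m -> nat}.
Implicit Types (la mu : shape) (i j : 'I_m) (u v w : seq 'I_m).

Definition incs i la : shape := [ffun k => la k + (k == i)].
Definition decs i la : shape := [ffun k => la k - (k == i)].

Definition dominant la := [forall i : 'I_m, forall j : 'I_m, (i <= j) ==> (la j <= la i)].

Lemma dominantP la :
  reflect (forall i j, i <= j -> la j <= la i) (dominant la).
Proof.
apply: (iffP forallP) => [H i j|H i]; first by move/forallP/(_ j)/implyP: (H i).
by apply/forallP=> j; apply/implyP/H.
Qed.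

(* npaths k la counts the standard tableaux of shape la, if la has size k. *)
Fixpoint npaths k la : nat :=
  if k is k'.+1 then
    if dominant la then \sum_(j | 0 < la j) npaths k' (decs j la) else 0
  else la == [ffun => 0].

Arguments npaths : simpl never.

Lemma npathsS k la : npaths k.+1 la =
  if dominant la then \sum_(j | 0 < la j) npaths k (decs j la) else 0.
Proof. by []. Qed.

Lemma npaths0 la : npaths 0 la = (la == [ffun => 0]).
Proof. by []. Qed.

Lemma incsK i : cancel (incs i) (decs i).
Proof. by move=> la; apply/ffunP=> k; rewrite !ffunE addnK. Qed.

Lemma decsK i la : 0 < la i -> incs i (decs i la) = la.
Proof.
by move=> la_i; apply/ffunP=> k; rewrite !ffunE; case: eqP => [->|_]; rewrite ?subnK ?subn0.
Qed.

Lemma decs_incs i j la : j != i -> decs j (incs i la) = incs i (decs j la).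
Proof.
move=> ji; apply/ffunP=> k; rewrite !ffunE.
by case: (eqVneq k j) => [->|kj]; rewrite ?(negPf ji) /= ?addn0 ?subn0.
Qed.

Lemma npaths_dominant k la : npaths k la != 0 -> dominant la.
Proof.
case: k => [|k]; last by rewrite npathsS; case: ifP.
by rewrite npaths0 eqb0 negbK => /eqP->; apply/dominantP=> i j _; rewrite !ffunE.
Qed.

(** The two shapes are the componentwise maximum and minimum of the partitions [la] and
    [incs i (decs j la)]. *)
Lemma dominant_incs_decs i j la : i != j -> 0 < la j -> dominant la ->
  dominant (incs i (decs j la)) -> dominant (incs i la) && dominant (decs j la).
Proof.
move=> ij laj /dominantP dla /dominantP dmu.
apply/andP; split; apply/dominantP=> a b ab; move: (dmu _ _ ab) (dla _ _ ab);
  rewrite !ffunE.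
  case: (eqVneq b i) => [->|_]; case: (eqVneq a i) => [->|_];
    rewrite ?(negPf ij) /= ?addn0 ?subn0 ?addn1 ?subn1; lia.
case: (eqVneq a j) => [->|_]; case: (eqVneq b j) => [->|_];
  rewrite 1?[j == i]eq_sym ?(negPf ij) /=; lia.
Qed.

Lemma npaths_incs_decs i j k la : i != j -> 0 < la j -> dominant la ->
  npaths k (incs i (decs j la)) * dominant (incs i la) =
  npaths k (incs i (decs j la)) * dominant (decs j la).
Proof.
move=> ij laj dla; have [->//|/npaths_dominant dmu] := eqVneq (npaths k (incs i (decs j la))) 0.
by have /andP[-> ->] := dominant_incs_decs ij laj dla dmu.
Qed.

End LatticeWords.

Arguments npaths : simpl never.

Section Corners.
Local Open Scope nat_scope.

(** The row after [j] can receive a box exactly when row [j] can lose one, both meaning a strict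
    drop between them; the first row can always receive one. *)
Lemma corners_count m (la : {ffun 'I_m -> nat}) : dominant la ->
  \sum_i la i < m ->
  \sum_i dominant (incs i la) = (\sum_(j | 0 < la j) dominant (decs j la)).+1.
Proof.
case: m la => [|m] la /dominantP dla lt_m; first by [].
rewrite big_ord_recl [in RHS]big_mkcond big_ord_recr /=.
have -> : dominant (incs ord0 la).
  apply/dominantP=> a b ab; have := dla _ _ ab; rewrite !ffunE.
  case: (eqVneq b ord0) => [b0|_] /=; last first.
    by rewrite addn0 => /leq_trans-> //; rewrite leq_addr.
  have -> : a = ord0 by apply: val_inj; move: ab; rewrite b0 /=; lia.
  by rewrite b0 eqxx.
(* The last row has no successor, but with fewer boxes than rows it is empty and has nothing to
   lose. *)
have -> : la ord_max = 0.
  apply/eqP; rewrite -leqn0 leqNgt; apply/negP=> pos.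
  suff : m.+1 <= \sum_i la i by rewrite leqNgt lt_m.
  rewrite -[X in X <= _]card_ord -sum1_card; apply: leq_sum => i _.
  by apply: leq_trans pos _; apply: dla; rewrite -ltnS.
rewrite /= addn0 add1n; congr _.+1; apply: eq_bigr => k _.
set i := lift ord0 k; set j := widen_ord _ k.
have ji : i = j.+1 :> nat by rewrite lift0.
have jNi : (j == i) = false by apply/negbTE; rewrite -val_eqE neq_ltn; apply/orP; left; rewrite -[X in _ < X]/(i : nat) ji.
have leji : j <= i by rewrite ji.
have -> : dominant (incs i la) = (la i < la j).
  apply/dominantP/idP => [H|lt a b ab].
    by have := H j i leji; rewrite !ffunE eqxx jNi addn1 addn0.
  have := dla _ _ ab; rewrite !ffunE; case: (eqVneq b i) => [bi|_]; last first.
    by rewrite addn0 => /leq_trans-> //; rewrite leq_addr.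
  case: (eqVneq a i) => [->|ai]; first by rewrite bi.
  rewrite /= addn0 addn1.
  have : la j <= la a.
    by apply: dla; rewrite -ltnS -ji ltn_neqAle -bi ab bi (inj_eq val_inj) ai.
  by rewrite bi; lia.
have [laj|] := posnP (la j); first by rewrite laj.
move=> laj; congr nat_of_bool; apply/idP/dominantP => [lt a b ab|H].
  have := dla _ _ ab; rewrite !ffunE; case: (eqVneq a j) => [aj|_]; last first.
    by rewrite subn0; apply: leq_trans; rewrite leq_subr.
  case: (eqVneq b j) => [->|bj]; first by rewrite aj.
  rewrite /= subn0 subn1.
  have : la b <= la i.
    by apply: dla; rewrite ji ltn_neqAle -aj ab aj (inj_eq val_inj) eq_sym bj.
  by rewrite aj; lia.
have := H j i leji; rewrite !ffunE eqxx [i == j]eq_sym jNi subn0 subn1; lia.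
Qed.

End Corners.

Section Counting.
Local Open Scope nat_scope.
Variable m : nat.
Local Notation shape := {ffun 'I_m -> nat}.
Implicit Types (la mu : shape) (i j : 'I_m) (u v w : seq 'I_m).

Lemma sum_incs i la : \sum_k incs i la k = (\sum_k la k).+1.
Proof.
rewrite (eq_bigr (fun k => la k + (k == i))) => [|k _]; last by rewrite ffunE.
by rewrite big_split /= -big_mkcond /= big_pred1_eq addn1.
Qed.

Lemma sum_decs j la : 0 < la j -> (\sum_k decs j la k).+1 = \sum_k la k.
Proof. by move=> laj; rewrite -(sum_incs j) decsK. Qed.

(* This is the commutation relation D U = U D + 1 of Young's lattice: adding a
   box and then removing another one can be done in either order, and there is
   one more addable box than there are removable ones. *)
Lemma sum_incs_npaths k la : dominant la -> \sum_i la i = k -> k < m ->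
  \sum_i npaths k.+1 (incs i la) = k.+1 * npaths k la.
Proof.
elim: k la => [|k IHk] la dla sum_la ltkm.
  have la0 i : la i = 0.
    by apply/eqP; rewrite -leqn0 -sum_la (bigD1 i) //= leq_addr.
  have npaths_la : npaths 0 la = 1.
    by rewrite npaths0 (_ : la == _) //; apply/eqP/ffunP=> i; rewrite la0 ffunE.
  have inner i : \sum_(j | 0 < incs i la j) npaths 0 (decs j (incs i la)) = 1.
    rewrite (big_pred1 i) ?incsK // => j; rewrite ffunE la0.
    by rewrite add0n lt0b.
  rewrite (eq_bigr (fun i => dominant (incs i la) : nat)) => [|i _]; last first.
    by rewrite npathsS inner; case: ifP.
  rewrite corners_count ?sum_la // big_pred0 ?npaths_la // => j.
  by rewrite la0.
pose X i j := npaths k.+1 (incs i (decs j la)).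
(* Removing the box just added ([j = i]) gives back [la]; the other removals are matched, through
   [X], with the terms of [rhs]. *)
have lhs i : npaths k.+2 (incs i la) =
    dominant (incs i la) * npaths k.+1 la +
    \sum_(j | (j != i) && (0 < la j)) X i j * dominant (incs i la).
  rewrite npathsS; case: (boolP (dominant _)) => _; last first.
    by rewrite big1 // => j _; rewrite muln0.
  rewrite (bigD1 i) /= ?ffunE ?eqxx ?addn1 // incsK mul1n; congr (_ + _).
  apply: eq_big => [j|j /andP[_ ji]]; last by rewrite muln1 /X decs_incs.
  by rewrite ffunE andbC; case: eqP; rewrite // addn0.
have rhs j : 0 < la j -> k.+1 * npaths k (decs j la) =
    dominant (decs j la) * npaths k.+1 la +
    \sum_(i | i != j) X i j * dominant (decs j la).
  move=> laj; case: (boolP (dominant _)) => [dlaj|ndlaj].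
    have sum_j : \sum_i decs j la i = k by have := sum_decs laj; lia.
    rewrite -(IHk _ dlaj sum_j (ltnW ltkm)) (bigD1 j) //= decsK // mul1n.
    by congr (_ + _); apply: eq_bigr => i _; rewrite muln1.
  rewrite (_ : npaths k _ = 0) ?muln0 ?big1 // => [i _|]; first by rewrite muln0.
  by apply/eqP; apply: contraNT ndlaj; apply: npaths_dominant.
rewrite (eq_bigr _ (fun i _ => lhs i)) big_split /= -big_distrl /=.
rewrite corners_count ?sum_la // mulSn [RHS]mulSn -addnA; congr (_ + _).
rewrite [in RHS]npathsS dla [in RHS]big_distrr [in RHS](eq_bigr _ rhs) big_split /= -big_distrl /=.
congr (_ + _).
rewrite (exchange_big_dep (fun j => 0 < la j)) => [/=|i j _ /andP[]//].
apply: eq_bigr => j laj; apply: eq_big => [i|i]; rewrite laj ?andbT 1?eq_sym //.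
by move=> ij; rewrite /X npaths_incs_decs.
Qed.

Definition word_shape w : shape := [ffun i => count_mem i w].

Lemma word_shape_cons i w : word_shape (i :: w) = incs i (word_shape w).
Proof. by apply/ffunP=> k; rewrite !ffunE /= addnC eq_sym. Qed.

(* Lattice words are read from right to left. *)
Fixpoint lattice w :=
  if w is i :: w' then lattice w' && dominant (word_shape w) else true.

Fixpoint lattice_words k : seq (seq 'I_m) :=
  if k is k'.+1 then
    [seq i :: w | w <- lattice_words k', i <- [seq i <- enum 'I_m | dominant (word_shape (i :: w))]]
  else [:: [::]].

Lemma lattice_wordsP k w :
  (w \in lattice_words k) = (size w == k) && lattice w.
Proof.
elim: k w => [|k IHk] w; first by rewrite inE; case: w.
apply/idP/idP => [/allpairsPdep[v [x []]]|/andP].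
  rewrite IHk mem_filter => /andP[/eqP <- lv] /andP[dv _] -> /=.
  by rewrite eqxx lv dv.
case: w => [|x w] [//=]; move=> sz /andP[lw dw].
apply/allpairsPdep; exists w, x.
by rewrite IHk mem_filter mem_enum dw -eqSS sz lw.
Qed.

Lemma lattice_words_uniq k : uniq (lattice_words k).
Proof.
elim: k => //= k IHk; apply: allpairs_uniq_dep => //.
  by move=> w _; rewrite filter_uniq ?enum_uniq.
by move=> [w i] [w' i'] _ _ /= [-> ->].
Qed.

Lemma lattice_dominant w : lattice w -> dominant (word_shape w).
Proof.
case: w => [_|i w /andP[]//]; apply/dominantP=> i j _.
by rewrite !ffunE.
Qed.

Lemma sum_word_shape w : \sum_i word_shape w i = size w.
Proof.
elim: w => [|i w IHw]; first by rewrite big1 // => i _; rewrite ffunE.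
by rewrite word_shape_cons sum_incs IHw.
Qed.

Lemma npaths_nondominant k la : ~~ dominant la -> npaths k la = 0.
Proof. by move=> nd; apply/eqP; apply: contraNT nd; apply: npaths_dominant. Qed.

Lemma count_lattice_words k la :
  count (fun w => word_shape w == la) (lattice_words k) = npaths k la.
Proof.
elim: k la => [|k IHk] la.
  by rewrite npaths0 /= addn0 eq_sym; congr (nat_of_bool (_ == _)); apply/ffunP=> i; rewrite !ffunE.
rewrite -sum1_count big_mkcond big_allpairs_dep /= npathsS.
case: ifP => [dla|/negbT ndla]; last first.
  rewrite big_seq big1 // => w wk; rewrite big1_seq // => i.
  rewrite mem_filter => /andP[_ /andP[dw _]].
  by case: eqP => // eq_la; rewrite -eq_la dw in ndla.
rewrite [RHS](eq_bigr (fun j => \sum_(w <- lattice_words k) (word_shape w == decs j la))).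
  rewrite exchange_big /=; apply: eq_bigr => w _.
  rewrite big_filter [RHS]big_mkcond -big_enum big_mkcond /=.
  apply: eq_bigr => i _; rewrite word_shape_cons.
  case: (ltnP 0 (la i)) => [lai|lai0].
    case: (eqVneq (word_shape w) (decs i la)) => [->|ne]; first by rewrite decsK // dla eqxx.
    case: ifP => // _; case: eqP => // eq_la.
    by rewrite -eq_la incsK eqxx in ne.
  case: ifP => // _; case: eqP => // eq_la.
  by move: lai0; rewrite -eq_la ffunE eqxx addn1.
by move=> j _; rewrite -IHk -sum1_count big_mkcond; apply: eq_bigr => w _; case: eqP.
Qed.

(** This is the sum of the squares of the numbers of tableaux: a word stands for a tableau and is
    weighted by the number of tableaux of its shape. Summing over the first letter produces the
    factor [k.+1]; [k <= m] leaves enough rows. *)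
Lemma sum_npaths_lattice_words k : k <= m ->
  \sum_(w <- lattice_words k) npaths k (word_shape w) = k`!.
Proof.
elim: k => [|k IHk] lekm.
  have -> : lattice_words 0 = [:: [::]] by [].
  have shape0 : word_shape [::] = [ffun => 0] by apply/ffunP=> i; rewrite !ffunE.
  by rewrite big_seq1 npaths0 shape0 eqxx.
rewrite factS -IHk ?(ltnW lekm) // big_distrr /= big_allpairs_dep /=.
rewrite big_seq [RHS]big_seq; apply: eq_bigr => w.
rewrite lattice_wordsP => /andP[/eqP sz lw].
rewrite -sum_incs_npaths ?sum_word_shape ?lattice_dominant //.
rewrite big_filter -big_enum [LHS]big_mkcond /=; apply: eq_bigr => i _.
by rewrite word_shape_cons; case: ifPn => // /npaths_nondominant->.
Qed.

End Counting.

(** * Standard tableaux from lattice words *)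

Section WordTableaux.
Local Open Scope nat_scope.
Variable n : nat.
Implicit Types (w a d : seq 'I_n) (k l : 'I_n).

(** The Yamanouchi correspondence: the letter in position [k] from the right is the row of the label
    [k], its earlier occurrences give the column. For a word of size [n] the default values are
    never taken. *)
Definition word_tab w : tableau n :=
  [ffun k => let r := nth k w (n - k.+1) in
             (r, insubd k (count_mem r (drop (n - k) w)))].

Lemma count_mem_split (r : 'I_n) w c : c < count_mem r w ->
  exists a d, w = a ++ r :: d /\ count_mem r d = c.
Proof.
elim: w => //= x w IHw ltc; have [lt|le] := ltnP c (count_mem r w).
  by have [a [d [-> cd]]] := IHw lt; exists (x :: a), d.
exists [::], w; move: ltc; case: eqP => [->|_] /=; last by rewrite ltnNge le.
by rewrite add1n ltnS => ltc; split=> //; apply/eqP; rewrite eqn_leq le.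
Qed.

Lemma word_tab_split w k : size w = n ->
  exists a d, [/\ w = a ++ (word_tab w k).1 :: d, size d = k &
                  count_mem (word_tab w k).1 d = (word_tab w k).2].
Proof.
move=> sz; exists (take (n - k.+1) w), (drop (n - k) w).
have ltkn := ltn_ord k.
have szd : size (drop (n - k) w) = k by rewrite size_drop sz; lia.
rewrite !ffunE /= szd; split=> //.
  rewrite -[LHS](cat_take_drop (n - k.+1)); congr (_ ++ _).
  by rewrite (drop_nth k) ?sz; [congr (_ :: drop _ w)|]; lia.
rewrite insubdK //; apply: leq_ltn_trans (ltn_ord k).
by rewrite -[X in _ <= X]szd count_size.
Qed.

Lemma word_tab_at w a r d : size w = n -> w = a ++ r :: d ->
  exists k, [/\ (word_tab w k).1 = r, k = size d :> nat &
                (word_tab w k).2 = count_mem r d :> nat].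
Proof.
move=> sz def_w; have ltdn : size d < n.
  by have := congr1 size def_w; rewrite sz size_cat /=; lia.
exists (Ordinal ltdn); have [a' [d' []]] := word_tab_split (Ordinal ltdn) sz.
rewrite {1}def_w => eq_cat sz_d <-.
have sz_a : size a = size a'.
  by have := congr1 size eq_cat; rewrite !size_cat /= sz_d /=; lia.
by move/eqP: eq_cat; rewrite eqseq_cat // => /andP[_ /eqP[<- <-]].
Qed.

Lemma lattice_catr a w : lattice (a ++ w) -> lattice w.
Proof. by elim: a => //= x a IHa /andP[/IHa]. Qed.

(** The suffix starting at the letter of [k] has a dominant shape, so the higher row [b.1] occurs in
    it often enough for the box [b] to be filled already. *)
Lemma word_tab_below w k b : size w = n -> lattice w ->
  box_le b (word_tab w k) -> exists2 l : 'I_n, l <= k & word_tab w l = b.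
Proof.
move=> sz lw /andP[le1 le2]; have [a [d [def_w sz_d cd]]] := word_tab_split k sz.
set r := (word_tab w k).1 in def_w cd le1.
have lx : lattice (r :: d) by apply: (@lattice_catr a); rewrite -def_w.
have : b.2 < count_mem b.1 (r :: d).
  have /dominantP/(_ _ _ le1) := lattice_dominant lx; rewrite !ffunE.
  by apply: leq_trans; rewrite /= eqxx add1n ltnS cd.
case/count_mem_split => a' [d' [def_x cd']].
have [|l [Tl1 sz_l Tl2]] := @word_tab_at w (a ++ a') b.1 d' sz.
  by rewrite -catA -def_x.
exists l; last by apply: box_eq; rewrite ?Tl1 ?Tl2.
by have := congr1 size def_x; rewrite size_cat /= sz_l sz_d; lia.
Qed.

Lemma word_tab_inj_at w : size w = n -> injective (word_tab w).
Proof.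
move=> sz k l eqT.
wlog ltkl : k l eqT / k < l.
  move=> wl; case: (ltngtP k l) => [lt|lt|/val_inj //]; first exact: wl.
  exact/esym/wl.
have [a [d [def_w sz_d cd]]] := word_tab_split k sz.
have [a' [d' [def_w' sz_d' cd']]] := word_tab_split l sz.
rewrite -eqT in def_w' cd'; set r := (word_tab w k).1 in def_w cd def_w' cd'.
have def_d : r :: d = drop (n - k.+1) w.
  rewrite [in RHS]def_w drop_size_cat //; have := congr1 size def_w.
  by rewrite size_cat sz /= sz_d; lia.
have def_d' : d' = drop (n - l) w.
  rewrite [in RHS]def_w' -cat_rcons drop_size_cat //; have := congr1 size def_w'.
  by rewrite size_cat size_rcons sz /= sz_d'; lia.
have sub : r :: d = drop (l - k.+1) d'.
  by rewrite def_d def_d' drop_drop; congr (drop _ w); have := ltn_ord l; lia.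
have : count_mem r (r :: d) <= count_mem r d'.
  by rewrite sub -{2}(cat_take_drop (l - k.+1) d') count_cat leq_addl.
by rewrite /= eqxx cd cd' ltnn.
Qed.

Lemma stdtab_word_tab w : size w = n -> lattice w -> stdtab (word_tab w).
Proof.
move=> sz lw; have injT := word_tab_inj_at sz; apply/stdtabP; split=> //.
  by move=> k b /(word_tab_below sz lw)[l _ <-]; exists l.
by move=> k l /(word_tab_below sz lw)[k' le_k'l /injT <-].
Qed.

Lemma word_tab_inj w w' : size w = n -> size w' = n ->
  word_tab w = word_tab w' -> w = w'.
Proof.
move=> sz sz' eqT; have [n0|n_gt0] := posnP n.
  by rewrite (size0nil (etrans sz n0)) (size0nil (etrans sz' n0)).
pose x0 : 'I_n := Ordinal n_gt0; apply: (@eq_from_nth _ x0); rewrite ?sz ?sz' // => m ltm.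
have lt_k : n - m.+1 < n by lia.
have /(congr1 (fun T : tableau n => (T (Ordinal lt_k)).1)) := eqT.
rewrite !ffunE /= (_ : n - (n - m.+1).+1 = m); last by lia.
by rewrite !(set_nth_default x0) ?sz ?sz'.
Qed.

Lemma codom_word_tab w b : size w = n -> lattice w ->
  (b \in codom (word_tab w)) = (b.2 < word_shape w b.1).
Proof.
move=> sz lw; rewrite ffunE; apply/codomP/idP => [[k ->]|].
  have [a [d [def_w _ <-]]] := word_tab_split k sz.
  by rewrite [X in _ < count _ X]def_w count_cat /= eqxx addnC add1n ltn_addr.
case/count_mem_split => a [d [def_w cd]].
have [k [Tk1 _ Tk2]] := word_tab_at sz def_w.
by exists k; apply: box_eq; rewrite ?Tk1 ?Tk2.
Qed.

Definition diagram (T : tableau n) : {set 'I_n * 'I_n} := [set b in codom T].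

Definition std_pairs : {set tableau n * tableau n} :=
  [set ST | [&& stdtab ST.1, stdtab ST.2 & diagram ST.1 == diagram ST.2]].

(** The inequality suffices: independent vectors indexed by these pairs will fill a space of
    dimension n!. *)
Lemma card_std_pairs_ge : n`! <= #|std_pairs|.
Proof.
rewrite -(sum_npaths_lattice_words (leqnn n)).
pose L := [seq (v, w) | v <- lattice_words n n,
  w <- [seq w <- lattice_words n n | word_shape w == word_shape v]].
have -> : \sum_(w <- lattice_words n n) npaths n (word_shape w) = size L.
  rewrite size_allpairs_dep sumnE big_map; apply: eq_bigr => w _.
  by rewrite size_filter count_lattice_words.
have uniqL : uniq L.
  apply: allpairs_uniq_dep; first exact: lattice_words_uniq.
    by move=> w _; rewrite filter_uniq ?lattice_words_uniq.
  by move=> [v w] [v' w'] _ _ /= [-> ->].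
pose f (vw : seq 'I_n * seq 'I_n) := (word_tab vw.1, word_tab vw.2).
have LP vw : vw \in L -> [/\ size vw.1 = n, lattice vw.1, size vw.2 = n,
    lattice vw.2 & word_shape vw.2 = word_shape vw.1].
  case/allpairsPdep => v [w []]; rewrite mem_filter !lattice_wordsP.
  by move=> /andP[/eqP? ?] /andP[/eqP ? /andP[/eqP ? ?]] ->.
rewrite -(size_map f) -(card_uniqP _); last first.
  rewrite map_inj_in_uniq // => vw vw' /LP[s1 _ s2 _ _] /LP[s1' _ s2' _ _] [].
  move=> /(word_tab_inj s1 s1') eq1 /(word_tab_inj s2 s2') eq2.
  by rewrite [vw]surjective_pairing [vw']surjective_pairing eq1 eq2.
apply/subset_leq_card/subsetP => _ /mapP[vw /LP[s1 l1 s2 l2 eqs] ->].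
rewrite inE /= !stdtab_word_tab //; apply/eqP/setP => b.
by rewrite !inE !codom_word_tab // eqs.
Qed.

End WordTableaux.

(** * The Specht module *)

Section Families.
Variables (F : fieldType) (m : nat) (K : finType).
Implicit Type u : K -> 'rV[F]_m.

Definition famx u : 'M[F]_(#|K|, m) :=
  \matrix_(r < #|K|) u (enum_val r).

Lemma famx_sub u x : (u x <= famx u)%MS.
Proof. by rewrite -[x]enum_rankK -(rowK (fun r => u (enum_val r))) row_sub. Qed.

Lemma famx_subP u p (U : 'M[F]_(p, m)) :
  reflect (forall x, u x <= U)%MS (famx u <= U)%MS.
Proof.
apply: (iffP row_subP) => [H x|H r]; last by rewrite rowK.
by have := H (enum_rank x); rewrite rowK enum_rankK.
Qed.

Lemma mul_famx u (a : 'rV[F]_#|K|) :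
  a *m famx u = \sum_x a 0 (enum_rank x) *: u x.
Proof.
rewrite mulmx_sum_row (reindex_onto (@enum_rank K) enum_val) => [|r _]; last exact: enum_valK.
by apply: eq_big => [x|x _]; rewrite ?enum_rankK ?eqxx ?rowK ?enum_rankK.
Qed.

End Families.

Section JointEigenvectors.
Variables (F : fieldType) (m : nat) (I J : finType).
Variables (v : I -> 'rV[F]_m) (M : J -> 'M[F]_m) (c : I -> J -> F).
Hypotheses (v_eigen : forall x y, v x *m M y = c x y *: v x)
  (v_neq0 : forall x, v x != 0)
  (c_sep : forall x x', (forall y, c x y = c x' y) -> x = x').

(* The projector is a polynomial in the operators, hence stabilises whatever
   they stabilise. *)
Lemma joint_projector x : exists Q : 'M[F]_m,
  [/\ forall x', x' != x -> v x' *m Q = 0,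
      exists2 d, d != 0 & v x *m Q = d *: v x &
      forall p (U : 'M[F]_(p, m)),
        (forall y, U *m M y <= U)%MS -> (U *m Q <= U)%MS].
Proof.
pose P x' y := c x y != c x' y.
have PW x' : x' != x -> exists y, P x' y.
  move=> ne; have [[y Py]|no] := altP (@existsP _ (P x')); first by exists y.
  case/eqP: ne; apply/esym/c_sep => y; apply/eqP.
  by rewrite -[_ == _]negbK; apply: contra no => ne; apply/existsP; exists y.
(* For [x' != x] some operator separates the two: the factor kills [v x'] and scales [v x] by a
   non-zero number. The default never enters the product. *)
pose Qf x' := if [pick y | P x' y] is Some y then M y - (c x' y)%:M else 1%:M.
pose cf z x' := if [pick y | P x' y] is Some y then c z y - c x' y else 1.
have QfE z x' : v z *m Qf x' = cf z x' *: v z.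
  rewrite /Qf /cf; case: pickP => [y _|_]; last by rewrite mulmx1 scale1r.
  by rewrite mulmxBr v_eigen mul_mx_scalar scalerBl.
exists (\big[mulmx/1%:M]_(x' <- enum I | x' != x) Qf x').
have prodE z : v z *m (\big[mulmx/1%:M]_(x' <- enum I | x' != x) Qf x') =
    (\prod_(x' <- enum I | x' != x) cf z x') *: v z.
  elim: (enum I) => [|x' s IHs]; first by rewrite !big_nil mulmx1 scale1r.
  rewrite !big_cons; case: ifP => // _.
  by rewrite mulmxA QfE -scalemxAl IHs scalerA.
split=> [x' x'x||p U stU].
- rewrite prodE (big_rem x') ?mem_enum //= x'x.
  rewrite {1}/cf; case: pickP => [y _|no]; first by rewrite subrr mul0r scale0r.
  by have [y Py] := PW x' x'x; rewrite no in Py.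
- exists (\prod_(x' <- enum I | x' != x) cf x x') => //.
  rewrite prodf_seq_neq0; apply/allP=> x' _; apply/implyP=> x'x.
  rewrite /cf; case: pickP => [y Py|_]; last exact: oner_neq0.
  by rewrite subr_eq0.
elim/big_rec: _ => [|x' Q _ IHQ]; first by rewrite mulmx1.
rewrite mulmxA; apply: submx_trans IHQ; apply: submxMr.
rewrite /Qf; case: pickP => [y _|_]; last by rewrite mulmx1.
by rewrite mulmxBr addmx_sub ?stU // mul_mx_scalar eqmx_opp scalemx_sub.
Qed.

Lemma joint_eigen_sum0 (a : I -> F) :
  \sum_x a x *: v x = 0 -> forall x, a x = 0.
Proof.
move=> sum0 x; have [Q [Q0 [d d0 Qd] _]] := joint_projector x.
move/(congr1 (mulmx^~ Q)): sum0; rewrite mul0mx mulmx_suml (bigD1 x) //=.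
rewrite big1 => [|x' x'x]; last by rewrite -scalemxAl Q0 // scaler0.
rewrite addr0 -scalemxAl Qd scalerA => /eqP.
by rewrite scaler_eq0 (negPf (v_neq0 x)) orbF mulf_eq0 (negPf d0) orbF => /eqP.
Qed.

Lemma joint_eigen_free : row_free (famx v).
Proof.
rewrite -kermx_eq0; apply/rowV0P => a /sub_kermxP; rewrite mul_famx => sum0.
apply/rowP=> r; rewrite mxE -[r]enum_valK.
exact: (joint_eigen_sum0 sum0).
Qed.

End JointEigenvectors.

Section SpechtBasis.
Variables (F : numFieldType) (n : nat).
Implicit Types (S T : tableau n) (i j k l : 'I_n) (g h p q s t : 'S_n).

Local Notation N := (gcard 'Sym_('I_n)).
Local Notation rho := (regular_repr F 'Sym_('I_n)).
Local Notation lmul := (@lmul F n).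
Local Notation ysym := (@ysym F n).

Lemma diagram_codom S T : diagram S = diagram T -> codom S =i codom T.
Proof. by move=> eqD b; have := congr1 (fun D : {set _} => b \in D) eqD; rewrite !inE. Qed.

Lemma diagram_permtab T h : diagram (permtab T h) = diagram T.
Proof. by apply/setP=> b; rewrite !inE codom_permtab. Qed.

Lemma permtabK T i j : permtab (permtab T (tperm i j)) (tperm i j) = T.
Proof. by apply/ffunP=> k; rewrite !ffunE tpermK. Qed.

Lemma jm_intertwine_nz m (a : 'S_n -> 'M[F]_m) T i j (v : 'rV[F]_m)
    (d := box_content (T j) - box_content (T i)) :
  palindromic a -> j = i.+1 :> nat -> 2 <= `|d| -> v != 0 -> jm_weight a T v ->
  v *m a (tperm i j) - (d%:~R)^-1 *: v != 0 /\
  jm_weight a (permtab T (tperm i j)) (v *m a (tperm i j) - (d%:~R)^-1 *: v).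
Proof.
move=> pal_a ij d2 v0 wv; have d0 : d != 0 by lia.
by split; [apply: jm_intertwine_neq0 => //; nia | apply: jm_intertwine].
Qed.

(** Only [T] moves here: right intertwiners commute with the left action, so they keep the left
    weight, and they stay inside the cyclic module. *)
Lemma ysym_cyclic_weights S : stdtab S -> row_sorted S ->
  forall T, stdtab T -> diagram S = diagram T ->
  exists v : 'rV[F]_N, [/\ v != 0, (v <= cyclic_mx rho (ysym S))%MS,
    jm_weight lmul S v & jm_weight rho T v].
Proof.
move=> sS rS; apply: (@col_sorted_ind n) => [T sT cT eqD|T i j sT ij lt IH eqD].
  have [h def_T] := same_diagram_perm sS sT (diagram_codom eqD).
  exists (ysym S *m rho (h^-1)%g); split.
  - have [injS _ _] := stdtabP _ sS.
    apply: contraNneq (ysym_neq0 F injS) => eq0.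
    have hG : h \in Sym 'I_n by rewrite inE.
    by rewrite -(repr_mxKV rho hG (ysym S)) eq0 mul0mx.
  - by apply: mxmodule_trans; rewrite ?cyclic_mx_module ?cyclic_mx_id ?inE.
  - apply: jm_weight_mulr; last exact: ysym_left_weight.
    by move=> k; rewrite regular_jm_lmul.
  rewrite ysym_permtab -def_T; apply: jm_weight_mulr; last exact: ysym_right_weight.
  by move=> k; rewrite lmul_jm_regular.
have [sT' ltc] := stdtab_col_descent sT ij lt.
have [|v [v0 vW lwv rwv]] := IH; first by rewrite diagram_permtab.
have [|y0 wy] := jm_intertwine_nz (repr_palindromic rho) ij _ v0 rwv.
  by rewrite !ffunE tpermL tpermR; move: ltc; lia.
rewrite permtabK in wy.
set y := _ - _ in y0 wy; exists y; split=> //.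
  rewrite /y addmx_sub ?eqmx_opp ?scalemx_sub //.
  by apply: mxmodule_trans; rewrite ?cyclic_mx_module ?inE.
move=> k; rewrite /y mulmxBl -mulmxA regular_jm_lmul mulmxA lwv.
by rewrite -!scalemxAl lwv scalerBr [in RHS]scalerA mulrC -scalerA.
Qed.

(** Here [S] is moved as well, by left intertwiners; these need not preserve the cyclic module, so
    membership in it is no longer claimed. *)
Lemma bi_weights S T : stdtab S -> stdtab T -> diagram S = diagram T ->
  exists v : 'rV[F]_N, [/\ v != 0, jm_weight lmul S v & jm_weight rho T v].
Proof.
move=> sS sT; move: S sS; apply: (@row_sorted_ind n) => [S sS rS eqD|S i j sS ij lt IH eqD].
  by have [v [v0 _ lv rv]] := ysym_cyclic_weights sS rS sT eqD; exists v.
have [sS' ltc] := stdtab_row_descent sS ij lt.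
have [|v [v0 lwv rwv]] := IH; first by rewrite diagram_permtab.
have [|y0 wy] := jm_intertwine_nz (lmul_palindromic F n) ij _ v0 lwv.
  by rewrite !ffunE tpermL tpermR; move: ltc; lia.
rewrite permtabK in wy.
set y := _ - _ in y0 wy; exists y; split=> //.
move=> k; rewrite /y mulmxBl -mulmxA lmul_jm_regular mulmxA rwv.
by rewrite -!scalemxAl rwv scalerBr [in RHS]scalerA mulrC -scalerA.
Qed.

End SpechtBasis.

Lemma card_sig_set (X : finType) (A : {set X}) : #|{: {x | x \in A}}| = #|A|.
Proof. by rewrite card_sig; apply: eq_card => x; rewrite inE. Qed.

Section SpechtModule.
Variables (F : numFieldType) (n : nat).
Implicit Types (T : tableau n) (i j k l : 'I_n) (g h p q s t : 'S_n).

Local Notation N := (gcard 'Sym_('I_n)).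
Local Notation rho := (regular_repr F 'Sym_('I_n)).
Local Notation lmul := (@lmul F n).
Local Notation ysym := (@ysym F n).

Variable S : tableau n.
Hypotheses (sS : stdtab S) (rS : row_sorted S).

Let W := cyclic_mx rho (ysym S).

Definition stdtabs : {set tableau n} :=
  [set T | stdtab T && (diagram T == diagram S)].

(** The eigenspace of a left Jucys-Murphy element is a right submodule, and it contains the
    generator. *)
Lemma specht_left_weight k :
  W *m jm lmul k = (box_content (S k))%:~R *: W.
Proof.
pose f := jm lmul k - (box_content (S k))%:~R%:M.
suff : (W <= kermx f)%MS.
  by move/sub_kermxP/eqP; rewrite mulmxBr mul_mx_scalar subr_eq0 => /eqP.
apply: cyclic_mx_sub.
  apply: kermx_centg_module; apply/centgmxP=> g _.
  by rewrite mulmxBl mulmxBr regular_jm_lmul scalar_mxC.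
apply/sub_kermxP; rewrite mulmxBr mul_mx_scalar ysym_left_weight //.
by rewrite subrr.
Qed.

Definition has_weight (U : 'M[F]_N) T :=
  exists v : 'rV[F]_N, [/\ v != 0, (v <= U)%MS & jm_weight rho T v].

Lemma jm_weight_free (u : {T | T \in stdtabs} -> 'rV[F]_N) :
  (forall x, u x != 0) -> (forall x, jm_weight rho (val x) (u x)) ->
  row_free (famx u).
Proof.
move=> u0 wu.
apply: (@joint_eigen_free _ _ _ _ u (jm rho)
  (fun x k => (box_content (val x k))%:~R)) => // x y eqc.
apply/val_inj/stdtab_content_inj => [||k]; last by apply/eqP; rewrite -(eqr_int F) eqc.
  by have := valP x; rewrite inE => /andP[].
by have := valP y; rewrite inE => /andP[].
Qed.

(* The n! vectors having a left weight S' and a right weight T, for standard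
   tableaux S' and T of the same shape, are a basis of the group algebra; those
   of left weight S span the Specht module. *)
Lemma specht_basis : exists u : {T | T \in stdtabs} -> 'rV[F]_N,
  [/\ forall x, u x != 0, forall x, (u x <= W)%MS,
      forall x, jm_weight rho (val x) (u x) & (W <= famx u)%MS].
Proof.
pose I := {ST | ST \in std_pairs n}.
have IP (x : I) : [/\ stdtab (val x).1, stdtab (val x).2 &
    diagram (val x).1 = diagram (val x).2].
  by have := valP x; rewrite inE => /and3P[? ? /eqP].
have /fin_all_exists[v vP] (x : I) : exists v : 'rV[F]_N,
    [/\ v != 0, jm_weight lmul (val x).1 v, jm_weight rho (val x).2 v &
        (val x).1 = S -> (v <= W)%MS].
  have [s1 s2 eqD] := IP x; have [eqS|neS] := eqVneq (val x).1 S.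
    have [|v [v0 vW lv rv]] := ysym_cyclic_weights F sS rS s2; first by rewrite -eqS.
    by exists v; rewrite eqS.
  have [v [v0 lv rv]] := bi_weights F s1 s2 eqD.
  by exists v; split=> // eqS; rewrite eqS eqxx in neS.
pose M (y : 'I_n + 'I_n) := match y with inl k => jm lmul k | inr k => jm rho k end.
pose c (x : I) (y : 'I_n + 'I_n) : F := match y with
  | inl k => (box_content ((val x).1 k))%:~R
  | inr k => (box_content ((val x).2 k))%:~R end.
have v_eigen x y : v x *m M y = c x y *: v x.
  by have [_ lv rv _] := vP x; case: y => k /=; rewrite ?lv ?rv.
have v_neq0 x : v x != 0 by have [] := vP x.
have c_sep x x' : (forall y, c x y = c x' y) -> x = x'.
  move=> eqc; have [s1 s2 _] := IP x; have [s1' s2' _] := IP x'.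
  apply: val_inj; rewrite [val x]surjective_pairing [val x']surjective_pairing.
  congr (_, _); apply: stdtab_content_inj => // k; apply/eqP; rewrite -(eqr_int F).
    by have /= -> := eqc (inl k).
  by have /= -> := eqc (inr k).
have free_v := joint_eigen_free v_eigen v_neq0 c_sep.
have full_v : row_full (famx v).
  rewrite -col_leq_rank (eqP free_v) card_sig_set /gcard card_Sym card_ord.
  exact: card_std_pairs_ge.
(* The default [0] never occurs, as [uE] shows. *)
pose u (x : {T | T \in stdtabs}) : 'rV[F]_N :=
  if insub (S, val x) is Some y then v y else 0.
have uE x : exists2 y, val y = (S, val x) & u x = v y.
  have SxI : (S, val x) \in std_pairs n.
    have := valP x; rewrite !inE /= => /andP[-> /eqP ->].
    by rewrite sS eqxx.
  by exists (Sub (S, val x) SxI); rewrite ?SubK // /u insubT.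
exists u; split=> [x|x|x|].
- by have [y _ ->] := uE x; have [] := vP y.
- by have [y eqy ->] := uE x; have [_ _ _] := vP y; rewrite eqy; apply.
- by have [y eqy ->] := uE x; have [_ _ + _] := vP y; rewrite eqy.
apply/row_subP=> r; set w := row r W.
have [a def_w] : exists a, w = a *m famx v by apply/submxP/submx_full.
(* [w] has left weight [S], so by independence its coordinates along other left weights vanish. *)
have a0 x : (val x).1 != S -> a 0 (enum_rank x) = 0.
  move=> neS; have [k nek] : exists k,
      box_content ((val x).1 k) != box_content (S k).
    apply/existsP; apply: contraNT neS; rewrite negb_exists => /forallP eqc.
    have [s1 _ _] := IP x; apply/eqP/stdtab_content_inj => // k.
    by apply/eqP; rewrite -[_ == _]negbK.
  pose ck : F := (box_content (S k))%:~R.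
  have : \sum_y (a 0 (enum_rank y) * (c y (inl k) - ck)) *: v y = 0.
    have : w *m jm lmul k - ck *: w = 0.
      by rewrite /w -row_mul specht_left_weight -linearZ /= subrr.
    rewrite def_w mul_famx mulmx_suml scaler_sumr -sumrB => eq0.
    rewrite -[RHS]eq0; apply: eq_bigr => y _.
    rewrite -scalemxAl (v_eigen y (inl k)) !scalerA -scalerBl.
    by rewrite mulrBr [ck * _]mulrC.
  move/(joint_eigen_sum0 v_eigen v_neq0 c_sep)/(_ x)/eqP.
  by rewrite mulf_eq0 subr_eq0 /= eqr_int (negPf nek) orbF => /eqP.
rewrite def_w mul_famx; apply: summx_sub => x _.
have [eqS|/a0->] := eqVneq (val x).1 S; last by rewrite scale0r sub0mx.
apply: scalemx_sub; have [s1 s2 eqD] := IP x.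
have Tx : (val x).2 \in stdtabs by rewrite inE s2 -eqD eqS eqxx.
suff -> : v x = u (Sub (val x).2 Tx) by apply: famx_sub.
have [y eqy ->] := uE (Sub (val x).2 Tx); congr (v _); apply: val_inj.
by rewrite eqy SubK -eqS -surjective_pairing.
Qed.

Lemma specht_rank : \rank W = #|stdtabs|.
Proof.
have [u [u0 uW wu Wu]] := specht_basis.
have -> : #|stdtabs| = \rank (famx u).
  by rewrite (eqP (jm_weight_free u0 wu)) card_sig_set.
by apply/eqP; rewrite eqn_leq !mxrankS //; apply/famx_subP.
Qed.

Lemma has_weight_swap (U : 'M[F]_N) T i j : mxmodule rho U -> j = i.+1 :> nat ->
  2 <= `|box_content (T j) - box_content (T i)| ->
  has_weight U T -> has_weight U (permtab T (tperm i j)).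
Proof.
move=> modU ij d2 [v [v0 vU wv]].
have [y0 wy] := jm_intertwine_nz (repr_palindromic rho) ij d2 v0 wv.
exists (v *m rho (tperm i j) - ((box_content (T j) - box_content (T i))%:~R)^-1 *: v).
split=> //; rewrite addmx_sub ?eqmx_opp ?scalemx_sub //.
by apply: mxmodule_trans; rewrite ?inE.
Qed.

(** Projecting a non-zero vector of [U] to a suitable weight gives a weight vector in [U]. Swaps
    lead from it down to [S], the only row-sorted tableau of the shape, and from there up to every
    tableau. *)
Lemma has_weight_full (U : 'M[F]_N) : mxmodule rho U -> (U <= W)%MS -> U != 0 ->
  forall T, T \in stdtabs -> has_weight U T.
Proof.
move=> modU UW U0.
have down T : stdtab T -> diagram T = diagram S -> has_weight U T -> has_weight U S.
  move: T; apply: (@row_sorted_ind n) => [T sT rT eqD|T i j sT ij lt IH eqD] wT.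
    by have <- : T = S by apply: row_sorted_uniq => //; apply: diagram_codom.
  have [sT' ltc] := stdtab_row_descent sT ij lt.
  apply: IH; first by rewrite diagram_permtab.
  by apply: has_weight_swap => //; lia.
have up T : stdtab T -> diagram T = diagram S -> has_weight U S -> has_weight U T.
  move: T; apply: (@row_sorted_ind n) => [T sT rT eqD|T i j sT ij lt IH eqD] wS.
    by have -> : T = S by apply: row_sorted_uniq => //; apply: diagram_codom.
  have [sT' ltc] := stdtab_row_descent sT ij lt.
  rewrite -(permtabK T i j); apply: has_weight_swap => //.
    by rewrite !ffunE tpermL tpermR; lia.
  by apply: IH => //; rewrite diagram_permtab.
have [T [sT eqD] wT] : exists2 T, stdtab T /\ diagram T = diagram S & has_weight U T.
  have [u [u0 uW wu Wu]] := specht_basis.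
  have /rowV0Pn[w wU w0] := U0.
  have /submxP[a def_w] : (w <= famx u)%MS by rewrite (submx_trans wU) ?(submx_trans UW).
  have [x ax] : exists x, a 0 (enum_rank x) != 0.
    apply/existsP; apply: contraNT w0; rewrite negb_exists => /forallP a0.
    rewrite def_w mul_famx big1 // => x _.
    by have := a0 x; rewrite negbK => /eqP->; rewrite scale0r.
  have := valP x; rewrite inE => /andP[sx /eqP Dx]; exists (val x) => //.
  have c_sep (y z : {T | T \in stdtabs}) : (forall k,
      (box_content (val y k))%:~R = (box_content (val z k))%:~R :> F) -> y = z.
    move=> eqc; apply/val_inj/stdtab_content_inj => [||k]; last first.
    - by apply/eqP; rewrite -(eqr_int F) eqc.
    - by have := valP z; rewrite inE => /andP[].
    by have := valP y; rewrite inE => /andP[].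
  have [Q [Q0 [d d0 Qd] stQ]] := @joint_projector _ _ _ _ u (jm rho)
    (fun x k => (box_content (val x k))%:~R) wu c_sep x.
  exists (u x); split=> //.
  have : (w *m Q <= U)%MS.
    apply: submx_trans (submxMr Q wU) (stQ _ _ _) => k.
    rewrite /jm mulmx_sumr; apply: summx_sub => l _.
    by have /mxmoduleP := modU; apply; rewrite inE.
  rewrite def_w mul_famx mulmx_suml (bigD1 x) //= big1 => [|y yx]; last first.
    by rewrite -scalemxAl Q0 // scaler0.
  by rewrite addr0 -scalemxAl Qd scalerA eqmx_scale // mulf_neq0.
by move=> T'; rewrite inE => /andP[sT' /eqP eqD']; apply/up/(down T).
Qed.

Lemma specht_simple : mxsimple rho W.
Proof.
split; first exact: cyclic_mx_module.
  have [injS _ _] := stdtabP _ sS.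
  by rewrite cyclic_mx_eq0 ysym_neq0.
move=> U modU UW U0.
have /fin_all_exists[u uP] (x : {T | T \in stdtabs}) :
  exists v : 'rV[F]_N, [/\ v != 0, (v <= U)%MS & jm_weight rho (val x) v].
  exact: has_weight_full (valP x).
have free_u : row_free (famx u).
  by apply: jm_weight_free => x; have [] := uP x.
rewrite -(geq_leqif (mxrank_leqif_sup UW)) specht_rank.
have -> : #|stdtabs| = \rank (famx u).
  by rewrite (eqP free_u) card_sig_set.
by rewrite mxrankS //; apply/famx_subP=> x; have [] := uP x.
Qed.

End SpechtModule.

(** * Spectrum of the shuffle on the Specht module *)

Section PairOperator.
Variables (F : numFieldType) (n : nat) (i j : 'I_n).
Hypothesis ij : j = i.+1 :> nat.
Implicit Types (T : tableau n).

Local Notation N := (gcard 'Sym_('I_n)).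
Local Notation rho := (regular_repr F 'Sym_('I_n)).
Local Notation ysym := (@ysym F n).
Local Notation s := (tperm i j).

(** This choice makes the sign times the difference of the two contents non-negative, which keeps
    [w] in [pair_eigenvector] from vanishing. Tableaux exchanged by [s] get opposite signs and
    account for both eigenvectors of [s] in their plane. *)
Definition tab_sign T : int :=
  if box_content (T i) < box_content (T j) then 1 else -1.

Definition tab_eigenvalue T : int :=
  tab_sign T * (box_content (T i) + box_content (T j)).

Definition pair_op : 'M[F]_N := (jm rho i + jm rho j) *m rho s.

(* If the contents differ by one then v is itself an eigenvector; the formula
   covers this case because w does not vanish. *)
Lemma pair_eigenvector T (v : 'rV[F]_N) (w := v + (tab_sign T)%:~R *: (v *m rho s)) :
  stdtab T -> v != 0 -> jm_weight rho T v ->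
  [/\ w != 0,
      w *m rho s = (tab_sign T)%:~R *: w,
      w *m (jm rho i + jm rho j) =
        (box_content (T i) + box_content (T j))%:~R *: w,
      w *m (jm rho i *m jm rho j) =
        (box_content (T i) * box_content (T j))%:~R *: w &
      forall k, k != i -> k != j -> w *m jm rho k = (box_content (T k))%:~R *: w].
Proof.
move=> sT v0 wv; rewrite {}/w.
set a := box_content (T i); set b := box_content (T j).
have pal := repr_palindromic rho.
have e2 : ((tab_sign T)%:~R : F) * (tab_sign T)%:~R = 1.
  by rewrite -intrM /tab_sign; case: ifP.
have vsi : v *m rho s *m jm rho i = b%:~R *: (v *m rho s) - v.
  by rewrite -mulmxA jm_mul_swap // mulmxBr mulmxA wv mulmx1 -scalemxAl.
have vsj : v *m rho s *m jm rho j = a%:~R *: (v *m rho s) + v.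
  by rewrite -mulmxA jm_mul_swap' // mulmxDr mulmxA wv mulmx1 -scalemxAl.
set e := (tab_sign T)%:~R in e2 *.
split.
- apply: contra v0; rewrite addrC addr_eq0 => /eqP eqv.
  have {}eqv : v *m rho s = - e *: v.
    by rewrite -[LHS]scale1r -e2 -scalerA eqv scalerN scaleNr.
  have : (e * (b - a)%:~R + 1) *: v = 0.
    have := vsj; rewrite eqv -scalemxAl wv -/b !scalerA => eq0.
    rewrite (_ : _ + 1 = a%:~R * - e + 1 - - e * b%:~R); last by rewrite rmorphB /=; ring.
    by rewrite !scalerBl scalerDl scale1r -eq0 subrr.
  move/eqP; rewrite scaler_eq0 => /orP[|//].
  (* The scalar is one plus the absolute value of the difference of the contents. *)
  rewrite -intrM -[1]/(1%:~R) -rmorphD /= intr_eq0 /tab_sign -/a -/b.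
  by case: ifP; lia.
- rewrite mulmxDl -scalemxAl -mulmxA pal_tpermK // mulmx1 scalerDr scalerA e2.
  by rewrite scale1r addrC.
- rewrite mulmxDl -scalemxAl !mulmxDr !wv vsi vsj -/a -/b.
  rewrite addrACA addNr addr0 -!scalerDl scalerDr !scalerA [(a + b)%:~R]intrD.
  congr (_ *: _ + _ *: _); ring.
- rewrite mulmxDl -scalemxAl !mulmxA wv vsi -scalemxAl wv mulmxBl -scalemxAl vsj wv.
  rewrite -/a -/b [b%:~R *: (_ + _)]scalerDr addrK !scalerA scalerDr !scalerA [(a * b)%:~R]intrM.
  congr (_ *: _ + _ *: _); ring.
move=> k ki kj; rewrite mulmxDl wv -scalemxAl -mulmxA jm_swap_other // mulmxA wv.
by rewrite -scalemxAl scalerDr !scalerA [X in _ + X *: _]mulrC.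
Qed.

(** The vectors [w y] are joint eigenvectors of [s], of the sum and the product of [jm rho i] and
    [jm rho j], and of the other Jucys-Murphy elements. These separate them, so they form a basis of
    the Specht module that diagonalises [pair_op]. *)
Lemma pair_rank S (x : int) : stdtab S -> row_sorted S ->
  \rank (cyclic_mx rho (ysym S) *m (pair_op - (x%:~R)%:M)) =
    #|[set T in stdtabs S | tab_eigenvalue T != x]|.
Proof.
move=> sS rS; have [u [u0 uW wu Wu]] := specht_basis F sS rS.
set W := cyclic_mx _ _ in uW Wu *; pose K := {T | T \in stdtabs S}.
pose w (y : K) := u y + (tab_sign (val y))%:~R *: (u y *m rho s).
have sK (y : K) : stdtab (val y) by have := valP y; rewrite inE => /andP[].
have wP y := pair_eigenvector (sK y) (u0 y) (wu y); rewrite -/(w _) in wP.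
pose M (k : option 'I_n) := if k is Some l then
    if l == i then jm rho i + jm rho j else
    if l == j then jm rho i *m jm rho j else jm rho l
  else rho s.
pose d (y : K) (k : option 'I_n) : int := let T := val y in
  if k is Some l then
    if l == i then box_content (T i) + box_content (T j) else
    if l == j then box_content (T i) * box_content (T j) else box_content (T l)
  else tab_sign T.
have w_eigen y k : w y *m M k = (d y k)%:~R *: w y.
  have [_ w1 w2 w3 w4] := wP y; case: k => [l|] //=.
  by rewrite /M /d; case: eqP => // /eqP li; case: eqP => // /eqP lj; rewrite w4.
have w0 y : w y != 0 by have [] := wP y.
have ji : (j == i) = false by rewrite -val_eqE /= ij; lia.
(* Sum and product give the two contents up to order; the sign fixes the order, since adjacent
   labels have distinct contents. *)
have d_sep (y z : K) : (forall k, (d y k)%:~R = (d z k)%:~R :> F) -> y = z.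
  move=> eqF; have {}eqF k : d y k = d z k by apply/eqP; rewrite -(eqr_int F) eqF.
  have e1 := eqF (Some i); have e2 := eqF (Some j); have e3 := eqF None.
  rewrite /= /d eqxx in e1; rewrite /= /d ji eqxx in e2; rewrite /= /tab_sign in e3.
  have ni (y' : K) := stdtab_consecutive (sK y') ij.
  have [eq_i eq_j] : box_content (val y i) = box_content (val z i) /\
                     box_content (val y j) = box_content (val z j).
    move: (ni y) (ni z) e1 e2 e3.
    set a := box_content (val y i); set b := box_content (val y j).
    set a' := box_content (val z i); set b' := box_content (val z j).
    move=> nab nab' e1 e2 e3.
    have lt_eq : (a < b) = (a' < b').
      by move: e3; case: ifP => _; case: ifP.
    have : (a - a') * (a - b') = 0.
      have -> : (a - a') * (a - b') = a ^+ 2 - a * (a' + b') + a' * b' by ring.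
      by rewrite -e1 -e2; ring.
    by move/eqP; rewrite mulf_eq0 !subr_eq0 => /orP[/eqP|/eqP]; lia.
  apply/val_inj/stdtab_content_inj => // k.
  have [->//|ki] := eqVneq k i; have [->//|kj] := eqVneq k j.
  by have := eqF (Some k); rewrite /d (negPf ki) (negPf kj).
have free_w := joint_eigen_free w_eigen w0 d_sep.
have wW y : (w y <= W)%MS.
  rewrite /w addmx_sub ?uW // scalemx_sub //.
  by apply: mxmodule_trans; rewrite ?cyclic_mx_module ?inE.
have eqW : (W :=: famx w)%MS.
  apply/eqmxP; have le : (famx w <= W)%MS by apply/famx_subP.
  rewrite le -(geq_leqif (mxrank_leqif_sup le)) (eqP free_w).
  by rewrite (specht_rank F sS rS) card_sig_set leqnn.
have wx y : w y *m (pair_op - (x%:~R)%:M) = ((tab_eigenvalue (val y) - x)%:~R) *: w y.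
  have [_ w1 w2 _ _] := wP y.
  rewrite mulmxBr /pair_op mulmxA w2 -scalemxAl w1 scalerA mul_mx_scalar -scalerBl.
  by rewrite -intrM -rmorphB /= mulrC.
rewrite (eqmxMr _ eqW).
pose K' := {y : K | tab_eigenvalue (val y) != x}.
pose w' (y : K') := w (val y).
have free_w' : row_free (famx w').
  apply: (@joint_eigen_free _ _ _ _ w' M (fun y k => (d (val y) k)%:~R)).
  - by move=> y k; apply: w_eigen.
  - by move=> y; apply: w0.
  by move=> y z eqd; apply/val_inj/d_sep.
have -> : (famx w *m (pair_op - (x%:~R)%:M) :=: famx w')%MS.
  apply/eqmxP/andP; split.
    apply/row_subP=> r; rewrite row_mul rowK wx.
    have [->|ne] := eqVneq (tab_eigenvalue (val (enum_val r))) x.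
      by rewrite subrr scale0r sub0mx.
    by apply: scalemx_sub; apply: (famx_sub w' (Sub (enum_val r) ne)).
  apply/famx_subP=> y; have ne := valP y.
  have <- : (((tab_eigenvalue (val (val y)) - x)%:~R)^-1 : F) *:
      (w (val y) *m (pair_op - (x%:~R)%:M)) = w' y.
    by rewrite wx scalerA mulVf ?scale1r // intr_eq0 subr_eq0.
  by apply/scalemx_sub/submxMr/famx_sub.
rewrite (eqP free_w') card_sig.
have inj_val : injective (fun y : K => val y) by apply: val_inj.
rewrite -(card_imset _ inj_val); apply: eq_card => T.
rewrite [RHS]inE; apply/imsetP/idP => [[y]|/andP[TS ne]].
  by rewrite inE => ne ->; rewrite ne andbT (valP y).
by exists (exist _ T TS : K) => //; rewrite inE.
Qed.

End PairOperator.

(** * Tableaux of a self-conjugate shape *)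

Section Shapes.
Variables (n : nat) (la : seq nat).
Hypothesis la_n : is_partition n la.
Implicit Types (T : tableau n) (i j k l : 'I_n) (b : 'I_n * 'I_n).

Local Open Scope nat_scope.

Lemma partition_nth_le (i j : nat) : i <= j -> nth 0 la j <= nth 0 la i.
Proof.
case/and3P: la_n => srt _ _ leij; have [ltj|lej] := ltnP j (size la); last first.
  by rewrite nth_default.
apply: (@sorted_leq_nth _ geq _ _ 0 la srt i j) => //.
- by move=> x y z /= yx xz; apply: leq_trans xz yx.
- by move=> x /=.
- by rewrite inE; apply: leq_ltn_trans leij ltj.
Qed.

Lemma partition_sum : sumn la = n.
Proof. by case/and3P: la_n => _ _ /eqP. Qed.

Lemma partition_size_le : size la <= n.
Proof.
case/and3P: la_n => _ n0 /eqP <-; elim: la n0 => //= x s IHs.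
by rewrite inE negb_or eq_sym -lt0n => /andP[x0 /IHs]; lia.
Qed.

Lemma partition_nth_le_sum r : nth 0 la r <= n.
Proof.
rewrite -partition_sum; elim: la r => [|x s IHs] [|r] //=; first exact: leq_addr.
exact: leq_trans (IHs r) (leq_addl _ _).
Qed.

Definition shape_diagram : {set 'I_n * 'I_n} :=
  [set b : 'I_n * 'I_n | b.2 < nth 0 la b.1].

Definition reading_tab : tableau n :=
  [ffun k : 'I_n => (insubd k (reshape_index la k), insubd k (reshape_offset la k))].

Lemma reading_tab1 k : (reading_tab k).1 = reshape_index la k :> nat.
Proof.
rewrite ffunE insubdK // unfold_in; apply: leq_trans partition_size_le.
by apply: reshape_indexP; rewrite partition_sum.
Qed.

Lemma reading_tab2 k : (reading_tab k).2 = reshape_offset la k :> nat.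
Proof.
rewrite ffunE insubdK // unfold_in.
have := @reshape_offsetP la k; rewrite partition_sum => /(_ (ltn_ord k)).
by move/leq_trans; apply; apply: partition_nth_le_sum.
Qed.

Lemma reading_tab_inj : injective reading_tab.
Proof.
move=> k l eqT; apply: val_inj; rewrite /= -(reshape_indexK la k).
by rewrite -reading_tab1 -reading_tab2 eqT reading_tab1 reading_tab2 reshape_indexK.
Qed.

Lemma codom_reading_tab b : (b \in codom reading_tab) = (b.2 < nth 0 la b.1).
Proof.
apply/codomP/idP => [[k ->]|ltb].
  by rewrite reading_tab1 reading_tab2 reshape_offsetP // partition_sum.
have := flatten_indexP ltb; rewrite partition_sum => ltn_b.
exists (Ordinal ltn_b); apply: box_eq.
  by rewrite reading_tab1 flatten_indexKl.
by rewrite reading_tab2 flatten_indexKr.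
Qed.

Lemma flatten_index_lt r r' c : c < nth 0 la r -> r < r' ->
  flatten_index la r c < sumn (take r' la).
Proof.
move=> ltc ltr; have ltr_sz : r < size la.
  by rewrite ltnNge; apply/negP=> le_sz; rewrite nth_default in ltc.
apply: (@leq_trans (sumn (take r.+1 la))).
  by rewrite (take_nth 0) // sumn_rcons ltn_add2l.
have -> : take r.+1 la = take r.+1 (take r' la) by rewrite take_takel.
by rewrite -{2}[take r' la](cat_take_drop r.+1) sumn_cat leq_addr.
Qed.

Lemma reading_tab_row_sorted : row_sorted reading_tab.
Proof.
move=> k l lekl; rewrite leqNgt; apply/negP=> lt.
have ltl : reshape_offset la l < nth 0 la (reading_tab l).1.
  by rewrite reading_tab1 reshape_offsetP // partition_sum.
have := flatten_index_lt ltl lt; rewrite reading_tab1 reshape_indexK => ltlk.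
have : sumn (take (reading_tab k).1 la) <= k.
  by rewrite -[X in _ <= X](reshape_indexK la) reading_tab1 leq_addr.
by move/(leq_trans ltlk); rewrite ltnNge lekl.
Qed.

Lemma card_shape_diagram : #|shape_diagram| = n.
Proof.
rewrite -[RHS](card_ord n) -(card_codom reading_tab_inj).
by apply: eq_card => b; rewrite codom_reading_tab inE.
Qed.

Lemma stdtab_reading_tab : stdtab reading_tab.
Proof.
apply/stdtabP; split; first exact: reading_tab_inj.
  move=> k b /andP[le1 le2].
  suff /codomP[l ->] : b \in codom reading_tab by exists l.
  have : reading_tab k \in codom reading_tab by apply: codom_f.
  rewrite !codom_reading_tab => /(leq_ltn_trans le2)/leq_trans; apply.
  exact: partition_nth_le.
move=> k l /andP[le1 le2]; rewrite leqNgt; apply/negP=> ltlk.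
have le1' := reading_tab_row_sorted (ltnW ltlk).
have eq1 : reshape_index la k = reshape_index la l.
  by rewrite -!reading_tab1; apply/eqP; rewrite eqn_leq le1.
move: ltlk; rewrite ltnNge -(reshape_indexK la k) -(reshape_indexK la l) eq1.
by rewrite leq_add2l -!reading_tab2 le2.
Qed.

(** An injective map into a diagram of [n] boxes is onto. Monotonicity along rows and columns
    extends to [box_le] through the corner in the row of one box and the column of the other. *)
Lemma Std_diagram T : (T \in Std n la) = stdtab T && (diagram T == shape_diagram).
Proof.
rewrite inE; apply/and4P/andP => [[/injectiveP injT /forallP inT /forallP rowT /forallP colT]|].
  have eqD : diagram T = shape_diagram.
    apply/eqP; rewrite eqEcard; apply/andP; split.
      by apply/subsetP=> b; rewrite !inE => /codomP[k ->]; apply: inT.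
    rewrite card_shape_diagram cardsE (card_codom injT) card_ord.
    exact: leqnn.
  split; last exact/eqP.
  have inD b : (b \in codom T) = (b.2 < nth 0 la b.1).
    by have := congr1 (fun D : {set _} => b \in D) eqD; rewrite !inE.
  apply/stdtabP; split=> //.
    move=> k b /andP[le1 le2]; suff /codomP[l ->] : b \in codom T by exists l.
    rewrite inD; apply: leq_trans (partition_nth_le le1).
    exact: leq_ltn_trans le2 (inT k).
  move=> k l /andP[le1 le2].
  have /codomP[m Tm] : ((T k).1, (T l).2) \in codom T.
    by rewrite inD /=; apply: leq_trans (inT l) (partition_nth_le le1).
  apply: (@leq_trans m).
    have := forallP (rowT k) m; rewrite -Tm /= eqxx /=.
    move: le2; rewrite leq_eqVlt => /orP[/eqP/val_inj eq2 _|lt2].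
      by rewrite (injT k m) // -Tm -eq2 -surjective_pairing.
    by rewrite lt2 => /ltnW.
  have := forallP (colT m) l; rewrite -Tm /= eqxx /=.
  move: le1; rewrite leq_eqVlt => /orP[/eqP/val_inj eq1 _|lt1].
    by rewrite (injT m l) // -Tm eq1 -surjective_pairing.
  by rewrite lt1 => /ltnW.
case=> /stdtabP[injT dT mT] /eqP eqD.
have inD b : (b \in codom T) = (b.2 < nth 0 la b.1).
  by have := congr1 (fun D : {set _} => b \in D) eqD; rewrite !inE.
split; first exact/injectiveP.
- by apply/forallP=> k; rewrite -inD codom_f.
- apply/forallP=> k; apply/forallP=> l; apply/implyP=> /andP[/eqP eq1 lt2].
  have /mT : box_le (T k) (T l) by rewrite /box_le eq1 leqnn ltnW.
  rewrite leq_eqVlt => /orP[/eqP/val_inj eqkl|//].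
  by rewrite eqkl ltnn in lt2.
apply/forallP=> k; apply/forallP=> l; apply/implyP=> /andP[/eqP eq2 lt1].
have /mT : box_le (T k) (T l) by rewrite /box_le eq2 leqnn andbT ltnW.
rewrite leq_eqVlt => /orP[/eqP/val_inj eqkl|//].
by rewrite eqkl ltnn in lt1.
Qed.

Lemma Std_stdtabs : Std n la = stdtabs reading_tab.
Proof.
apply/setP=> T; rewrite Std_diagram inE; congr (_ && (_ == _)).
by apply/setP=> b; rewrite !inE codom_reading_tab.
Qed.

Lemma young_symmetrizer_ysym (F : numFieldType) :
  young_symmetrizer F n la = ysym F reading_tab.
Proof.
have eR : row_stab n la = rowst reading_tab.
  apply/setP=> p; rewrite !inE; apply: eq_forallb => k.
  by rewrite -val_eqE /= !reading_tab1.
have eC : col_stab n la = colst reading_tab.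
  apply/setP=> p; rewrite !inE; apply: eq_forallb => k.
  by rewrite -val_eqE /= !reading_tab2.
rewrite /young_symmetrizer /ysym eR eC linear_sum; apply: eq_bigr => p _.
rewrite linear_sum; apply: eq_bigr => q _.
by rewrite linearZ /= gring_row_regular.
Qed.

Lemma count_gt_partition (i j : nat) : (i < count (fun r => j < r) la) = (j < nth 0 la i).
Proof.
case/and3P: la_n => srt _ _; elim: la srt i => [|x s IHs] srt i.
  by rewrite nth_nil.
have srt_s := path_sorted srt; rewrite /= in srt *.
have [ltjx|lexj] := ltnP j x.
  by rewrite add1n; case: i => [|i] //=; rewrite ltnS IHs.
have s0 r : r \in s -> j < r = false.
  move=> rs; apply/negbTE; rewrite -leqNgt; apply: leq_trans lexj.
  have trans : transitive geq by move=> a b c /= ba ac; apply: leq_trans ac ba.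
  by have /allP := order_path_min trans srt; apply.
rewrite add0n (_ : count _ s = 0); last first.
  by apply/eqP; rewrite -leqn0 leqNgt -has_count; apply/hasPn=> r /s0->.
rewrite ltn0; apply/esym/negbTE; rewrite -leqNgt.
case: i => [|i] //=; have [lti|lei] := ltnP i (size s); last by rewrite nth_default.
by rewrite leqNgt s0 // mem_nth.
Qed.

Hypothesis la_sc : self_conjugate la.

Lemma shape_diagram_sym (i j : nat) : (i < nth 0 la j) = (j < nth 0 la i).
Proof.
rewrite -count_gt_partition -{2}(eqP la_sc) /conj_part.
have [lti|lei] := ltnP i (head 0 la); first by rewrite nth_mkseq.
rewrite nth_default ?size_mkseq // ltn0 count_gt_partition.
apply/negbTE; rewrite -leqNgt (leq_trans _ lei) // -nth0.
exact: partition_nth_le.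
Qed.

Lemma Std_tr T : (trtab T \in Std n la) = (T \in Std n la).
Proof.
suff impl T' : T' \in Std n la -> trtab T' \in Std n la.
  by apply/idP/idP => /impl; rewrite ?trtabK.
rewrite !Std_diagram => /andP[sT /eqP eqD]; rewrite stdtab_tr //=.
apply/eqP/setP=> b; rewrite !inE.
have := congr1 (fun D : {set _} => (b.2, b.1) \in D) eqD; rewrite !inE /=.
rewrite -shape_diagram_sym => <-; apply/codomP/codomP => -[k eqb]; exists k.
  by rewrite eqb ffunE /= -surjective_pairing.
by rewrite ffunE -eqb /= -surjective_pairing.
Qed.

End Shapes.

Section Content.
Variable n : nat.
Implicit Type T : tableau n.

Lemma contentE T (k : 'I_n) m : m = k.+1 -> content T m = box_content (T k).
Proof.
move=> ->; rewrite /content /= /codom /image_mem -map_comp.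
by rewrite (nth_map k) ?size_enum_ord //= nth_ord_enum.
Qed.

End Content.

(** * Upper tableaux and the values they provide *)

Section Upper.
Variables (n : nat) (la : seq nat).
Hypotheses (la_n : is_partition n la) (la_sc : self_conjugate la).
Implicit Types (T : tableau n) (i j k l : 'I_n).

Lemma UStd_Std T : T \in UStd n la -> T \in Std n la.
Proof. by rewrite inE => /andP[]. Qed.

Lemma stdtab_first T k : stdtab T -> k = 0 :> nat -> (T k).1 = 0 :> nat /\ (T k).2 = 0 :> nat.
Proof.
move=> /stdtabP[injT dT mT] k0; have kmin l : (l <= k)%N -> l = k.
  by rewrite k0 leqn0 => /eqP l0; apply: val_inj; rewrite /= l0.
have [l Tl] : exists l, T l = (k, k) by apply: (dT k); rewrite /box_le /= k0.
by rewrite -(kmin l) ?Tl //; apply: mT; rewrite Tl /box_le /= k0.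
Qed.

Lemma stdtab_second T k : stdtab T -> k = 1%N :> nat ->
  box_content (T k) = 1 \/ box_content (T k) = -1.
Proof.
move=> sT k1; have [injT dT mT] := stdtabP _ sT.
have n_gt0 : (0 < n)%N by apply: leq_trans (ltn_ord k); rewrite k1.
pose z := Ordinal n_gt0; have [z1 z2] := stdtab_first sT (erefl : z = 0 :> nat).
have below b : box_le b (T k) -> b != T k -> b.1 = 0 :> nat /\ b.2 = 0 :> nat.
  move=> bk nb; have [l Tl] := dT _ _ bk; have lelk : (l <= k)%N by apply: mT; rewrite Tl.
  suff -> : b = T z by [].
  rewrite -Tl; congr (T _); apply: val_inj => /=; move: lelk.
  by rewrite k1 leq_eqVlt ltnS leqn0 -k1 => /orP[/eqP/val_inj lk|/eqP //]; rewrite -lk Tl eqxx in nb.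
have nz : T k != T z by apply/eqP=> /injT kz; move: k1; rewrite kz.
have [r0|r_gt0] := posnP (T k).1.
  have [c0|c_gt0] := posnP (T k).2.
    by case/eqP: nz; apply: box_eq; rewrite ?z1 ?z2.
  have ltc : ((T k).2.-1 < n)%N by apply: leq_ltn_trans (leq_pred _) (ltn_ord (T k).2).
  have [||_ /= c1] := below ((T k).1, Ordinal ltc).
  - by rewrite /box_le /= leqnn leq_pred.
  - by apply/eqP=> /(congr1 (fun b => val b.2)) /=; lia.
  by left; rewrite /box_content r0; lia.
have ltr : ((T k).1.-1 < n)%N by apply: leq_ltn_trans (leq_pred _) (ltn_ord (T k).1).
have [||/= r1 c0] := below (Ordinal ltr, (T k).2).
- by rewrite /box_le /= leqnn leq_pred.
- by apply/eqP=> /(congr1 (fun b => val b.1)) /=; lia.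
by right; rewrite /box_content c0; lia.
Qed.

(** The sum depends only on the diagram, and transposition preserves the diagram while changing the
    sign. *)
Lemma sum_content0 T : T \in Std n la -> \sum_k box_content (T k) = 0.
Proof.
move=> TS; have sumD T' : T' \in Std n la ->
    \sum_k box_content (T' k) = \sum_(b in shape_diagram n la) box_content b.
  rewrite (Std_diagram la_n) => /andP[/stdtabP[injT _ _] /eqP <-].
  rewrite (eq_bigl (fun b => b \in [set T' k | k in 'I_n])); last first.
    move=> b; rewrite inE; apply/codomP/imsetP => -[k]; first by move=> ->; exists k.
    by move=> _ ->; exists k.
  by rewrite big_imset //= => k l _ _ /injT.
have TS' : trtab T \in Std n la by rewrite (Std_tr la_n).
have : \sum_k box_content (trtab T k) = - \sum_k box_content (T k).
  by rewrite -sumrN; apply: eq_bigr => k _; rewrite trtab_content.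
by rewrite !sumD //; lia.
Qed.

Lemma UStd_n_ge2 T : T \in UStd n la -> (1 < n)%N.
Proof.
rewrite inE => /andP[_]; apply: contraLR; rewrite -leqNgt => len.
by rewrite /content nth_default // size_map size_codom card_ord.
Qed.

(** Swapping the last two labels must not touch label 2. Contents 0 and 1 do not sum to zero, which
    excludes [n = 2]; for [n = 3] the last content is -1 and the list is empty. *)
Lemma eigenvalues_of_n_ge4 T x : T \in UStd n la -> x \in eigenvalues_of T ->
  (3 < n)%N.
Proof.
move=> TU; have n1 := UStd_n_ge2 TU; have TS := UStd_Std TU.
have c2 : content T 2 = 1 by move: TU; rewrite inE => /andP[_ /eqP].
have c1 : content T 1 = 0.
  rewrite (@contentE _ T (Ordinal (ltnW n1))) //.
  have sT : stdtab T by move: TS; rewrite (Std_diagram la_n) => /andP[].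
  have [r0 c0] := @stdtab_first T (Ordinal (ltnW n1)) sT erefl.
  by rewrite /box_content r0 c0.
have := sum_content0 TS.
rewrite (eq_bigr (fun k : 'I_n => content T k.+1)) => [|k _]; last by rewrite (@contentE _ T k).
rewrite -(big_mkord xpredT (fun k : nat => content T k.+1)).
case: (ltnP 3 n) => // len; have [n2|n3] : n = 2%N \/ n = 3%N by lia.
  by rewrite [X in index_iota 0 X]n2 !big_nat_recr //= big_geq // c1 c2.
rewrite [X in index_iota 0 X]n3 !big_nat_recr //= big_geq // c1 c2 => sum0.
rewrite /eigenvalues_of [X in content T X.-1]n3 [X in content T X]n3 /= c2.
have -> : content T 3 = -1 by move: sum0; lia.
by [].
Qed.

Section LastTwo.
Variables (i j : 'I_n).
Hypotheses (ij : j = i.+1 :> nat) (jn : j.+1 = n).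

Local Notation ev := (tab_eigenvalue i j).
Local Notation s := (tperm i j).

Lemma content_last T : content T n = box_content (T j).
Proof. exact: contentE. Qed.

Lemma content_penultimate T : content T n.-1 = box_content (T i).
Proof. by apply: contentE; rewrite -ij -[in LHS]jn. Qed.

Lemma Std_stdtab T : T \in Std n la -> stdtab T.
Proof. by rewrite (Std_diagram la_n) => /andP[]. Qed.

Lemma tab_eigenvalue_tr T : stdtab T -> ev (trtab T) = ev T.
Proof.
move=> sT; have := stdtab_consecutive sT ij.
rewrite /tab_eigenvalue /tab_sign !trtab_content ltrN2.
by case: (ltrgtP (box_content (T i)) (box_content (T j))) => // _ _; ring.
Qed.

(** If the boxes were comparable, every box between them would be one of the two, so they would be
    neighbours. *)
Lemma stdtab_far T : stdtab T ->
  box_content (T j) != box_content (T i) + 1 ->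
  box_content (T j) != box_content (T i) - 1 -> ~~ box_le (T i) (T j).
Proof.
move=> sT ne1 ne2; have [injT dT mT] := stdtabP _ sT.
apply/negP=> /andP[le1 le2].
have btw b : box_le (T i) b -> box_le b (T j) -> b = T i \/ b = T j.
  move=> ib bj; have [l Tl] := dT _ _ bj.
  have il : (i <= l)%N by apply: mT; rewrite Tl.
  have lj : (l <= j)%N by apply: mT; rewrite Tl.
  have [|] : l = i :> nat \/ l = j :> nat by lia.
    by move/val_inj => <-; left.
  by move/val_inj => <-; right.
have nij : T i <> T j by move/injT/(congr1 val) => /=; rewrite ij; lia.
(* The candidates are the neighbours of [T i] below and to the right, cut off at [T j] so as to stay
   between the two boxes. *)
have le1n : (minn (T i).1.+1 (T j).1 < n)%N.
  by rewrite gtn_min ltn_ord orbT.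
have le2n : (minn (T i).2.+1 (T j).2 < n)%N.
  by rewrite gtn_min ltn_ord orbT.
have b1 := btw (Ordinal le1n, (T i).2); have b2 := btw ((T i).1, Ordinal le2n).
move: ne1 ne2 b1 b2 nij; rewrite /box_le /box_content /=.
case: (T i) (T j) le1 le2 le1n le2n {btw dT mT} => [r c] [r' c'] /= le1 le2 l1 l2 ne1 ne2 b1 b2 nij.
have nrc : ~ (r = r' :> nat /\ c = c' :> nat).
  by case=> /val_inj er /val_inj ec; apply: nij; rewrite er ec.
have [||/(congr1 (fun b => val b.1)) /= e1|e1] := b1;
  try by rewrite ?leqnn ?andbT ?leq_min ?geq_min ?leqnn ?leqnSn ?le1 ?le2 ?orbT.
  have [||/(congr1 (fun b => val b.2)) /= e2|e2] := b2;
    try by rewrite ?leqnn ?andbT ?leq_min ?geq_min ?leqnn ?leqnSn ?le1 ?le2 ?orbT.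
    by apply: nrc; lia.
  have /= e3 := congr1 (fun b => val b.1) e2.
  by have /= e4 := congr1 (fun b => val b.2) e2; lia.
have /= e3 := congr1 (fun b => val b.1) e1.
by have /= e4 := congr1 (fun b => val b.2) e1; lia.
Qed.

Lemma Std_swap T : T \in Std n la ->
  box_content (T j) != box_content (T i) + 1 ->
  box_content (T j) != box_content (T i) - 1 -> permtab T s \in Std n la.
Proof.
rewrite !(Std_diagram la_n) => /andP[sT eqD] ne1 ne2.
by rewrite stdtab_swap ?stdtab_far //= diagram_permtab.
Qed.

Hypothesis n_gt3 : (3 < n)%N.

Lemma content2_swap T : content (permtab T s) 2 = content T 2.
Proof.
have lt1n : (1 < n)%N by lia.
rewrite !(@contentE _ _ (Ordinal lt1n)) // ffunE tpermD // -val_eqE /=; lia.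
Qed.

Lemma content2_tr T : content (trtab T) 2 = - content T 2.
Proof.
have lt1n : (1 < n)%N by lia.
by rewrite !(@contentE _ _ (Ordinal lt1n)) // trtab_content.
Qed.

(** Transposition negates both the sign and the sum, hence keeps the eigenvalue, and exchanges upper
    tableaux with the others. *)
Lemma card_Std_eigenvalue x :
  #|[set T in Std n la | ev T == x]| = (2 * #|[set T in UStd n la | ev T == x]|)%N.
Proof.
have lt1n : (1 < n)%N by lia.
have UE T : (T \in UStd n la) = (T \in Std n la) && (content T 2 == 1).
  by apply/setIdP/andP.
pose upper : {set tableau n} := [set T | content T 2 == 1].
have upperE T : (T \in upper) = (content T 2 == 1) by rewrite in_set.
rewrite -(cardsID upper) mul2n -addnn; congr (_ + _)%N.
  apply: eq_card => T; rewrite in_setI upperE.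
  apply/andP/setIdP => [[/setIdP[TS evx] c2]|[]]; rewrite UE; first by rewrite TS.
  by case/andP=> TS c2 evx; split=> //; apply/setIdP.
rewrite -[RHS](card_imset _ (inv_inj (@trtabK n))); apply: eq_card => T.
rewrite in_setD upperE; apply/andP/imsetP => [[c2 /setIdP[TS evx]]|[T']].
  exists (trtab T); last by rewrite trtabK.
  apply/setIdP; rewrite UE (Std_tr la_n la_sc) TS content2_tr.
  rewrite tab_eigenvalue_tr ?Std_stdtab //; split=> //=.
  move: c2; rewrite (@contentE _ _ (Ordinal lt1n)) //.
  by case: (@stdtab_second T (Ordinal lt1n) (Std_stdtab TS) erefl) => ->.
case/setIdP; rewrite UE => /andP[TS c2] evx ->.
rewrite content2_tr (eqP c2); split=> //; apply/setIdP.
by rewrite (Std_tr la_n la_sc) tab_eigenvalue_tr ?Std_stdtab.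
Qed.

(** Each tableau has one value [ev], whereas [eigenvalues_of] lists two opposite values for an
    ascending far pair and none for a descending one. Swapping the last two labels matches these
    cases and negates [ev]. *)
Lemma card_UStd_eigenvalue x :
  #|[set T in UStd n la | ev T == x]| =
  (\sum_(T in UStd n la) count_mem x (eigenvalues_of T))%N.
Proof.
have UE T : (T \in UStd n la) = (T \in Std n la) && (content T 2 == 1).
  by apply/setIdP/andP.
pose far T := (box_content (T j) != box_content (T i) + 1) &&
              (box_content (T j) != box_content (T i) - 1).
pose asc T := box_content (T i) < box_content (T j).
have sK : involutive (fun T => permtab T s) by move=> T; apply: permtabK.
have farS T : far (permtab T s) = far T.
  by rewrite /far !ffunE tpermL tpermR; lia.
have US T : far T -> (permtab T s \in UStd n la) = (T \in UStd n la).
  suff impl T' : far T' -> T' \in UStd n la -> permtab T' s \in UStd n la.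
    move=> fT; apply/idP/idP; last exact: impl.
    by move/impl; rewrite permtabK; apply; rewrite farS.
  by move=> /andP[ne1 ne2]; rewrite !UE content2_swap => /andP[/Std_swap-> //].
have evS T : stdtab T -> ev (permtab T s) = - ev T.
  move=> sT; have := stdtab_consecutive sT ij.
  rewrite /tab_eigenvalue /tab_sign !ffunE tpermL tpermR.
  by case: (ltrgtP (box_content (T i)) (box_content (T j))) => // _ _; ring.
have ascS T : stdtab T -> asc (permtab T s) = ~~ asc T.
  move=> sT; have := stdtab_consecutive sT ij.
  by rewrite /asc !ffunE tpermL tpermR; lia.
rewrite -sum1dep_card big_mkcondr /=.
rewrite (bigID far) /= [RHS](bigID far) /= addnC [RHS]addnC; congr (_ + _)%N.
  apply: eq_bigr => T /andP[TU nfar].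
  rewrite /eigenvalues_of content_last content_penultimate.
  move: nfar; rewrite /far /tab_eigenvalue /tab_sign.
  set a := box_content (T i); set b := box_content (T j).
  case: (eqVneq b (a + 1)) => [->|_] /=.
    move=> _; have -> : a < a + 1 by lia.
    have -> : 1 * (a + (a + 1)) = 2 * (a + 1) - 1 by ring.
    by rewrite addn0; case: eqP.
  case: (eqVneq b (a - 1)) => [->|//] _ /=.
  have -> : (a < a - 1) = false by lia.
  have -> : -1 * (a + (a - 1)) = - (2 * (a - 1) + 1) by ring.
  by rewrite addn0; case: eqP.
rewrite (bigID asc) /= [RHS](bigID asc) /=.
rewrite [X in _ = (_ + X)%N]big1 ?addn0; last first.
  move=> T /andP[/andP[_ /andP[ne1 ne2]]]; rewrite /eigenvalues_of content_last content_penultimate.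
  by rewrite (negPf ne1) (negPf ne2) /asc => /negPf->.
rewrite [X in (_ + X)%N = _](reindex_inj (inv_inj sK)) /=.
have sU T : T \in UStd n la -> stdtab T by move/UStd_Std/Std_stdtab.
rewrite [X in (_ + X)%N = _](eq_bigl (fun T => [&& T \in UStd n la, far T & asc T])); last first.
  move=> T; rewrite farS; case: (boolP (far T)) => fT; rewrite ?andbF //=.
  by rewrite US //= andbT; case: (boolP (T \in _)) => //= /sU/ascS->; rewrite negbK.
rewrite [X in (X + _)%N = _](eq_bigl (fun T => [&& T \in UStd n la, far T & asc T])); last first.
  by move=> T; rewrite andbA.
rewrite -big_split /=; apply: eq_big => [T|T /and3P[TU /andP[ne1 ne2] aT]].
  by rewrite andbA.
rewrite /eigenvalues_of content_last content_penultimate (negPf ne1) (negPf ne2).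
rewrite -/(asc T) aT /= addn0 evS ?sU // /tab_eigenvalue /tab_sign -/(asc T) aT mul1r.
by rewrite [_ + box_content (T j)]addrC; do 2!case: eqP.
Qed.

End LastTwo.
End Upper.

(** * Restriction to the alternating group *)

Section Shuffle.
Variables (F : numClosedFieldType) (n : nat).
Implicit Types (i j k l : 'I_n) (g h : 'S_n).

(** An arbitrary map on permutations is allowed, so that the same expression makes sense in regular
    representations, submodules and irreducible components. *)
Definition shuffle_in m (r : 'S_n -> 'M[F]_m) : 'M[F]_m :=
  r 1%g +
  \sum_(i < n | (i.+2 < n)%N)
    \sum_(j < n | j.+2 == n) \sum_(k < n | k.+1 == n)
      (r (cycle3 i j k) + r (cycle3 i k j)).

Lemma shuffle_in_op : shuffle_op F n = shuffle_in (regular_repr F 'Alt_('I_n)).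
Proof. by rewrite /shuffle_in repr_mx1. Qed.

Lemma cycle3_Alt i j k : i != j -> i != k -> cycle3 i j k \in Alt 'I_n.
Proof. by move=> ij ik; rewrite Alt_even odd_mul_tperm odd_tperm ij ik. Qed.

(** The shuffle is linear in [r] and evaluates it at even permutations only. The matrices on both
    sides admit intertwiners placed on the left or on the right. *)
Lemma shuffle_in_inter p q m1 m2 (r1 : 'S_n -> 'M[F]_m1) (r2 : 'S_n -> 'M[F]_m2)
    (A1 : 'M[F]_(p, m1)) (B1 : 'M[F]_(m1, q)) (A2 : 'M[F]_(p, m2)) (B2 : 'M[F]_(m2, q)) :
  (forall g, g \in Alt 'I_n -> A1 *m r1 g *m B1 = A2 *m r2 g *m B2) ->
  A1 *m shuffle_in r1 *m B1 = A2 *m shuffle_in r2 *m B2.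
Proof.
move=> eqAB; rewrite /shuffle_in !mulmxDr !mulmxDl eqAB ?group1 //.
congr (_ + _); rewrite !mulmx_sumr !mulmx_suml; apply: eq_bigr => i lti.
rewrite !mulmx_sumr !mulmx_suml; apply: eq_bigr => j /eqP jn.
rewrite !mulmx_sumr !mulmx_suml; apply: eq_bigr => k /eqP kn.
have ij : i != j by rewrite -val_eqE /=; lia.
have ik : i != k by rewrite -val_eqE /=; lia.
by rewrite !mulmxDr !mulmxDl !eqAB ?cycle3_Alt.
Qed.

Lemma shuffle_in_inter_sub (c : F) m1 m2 (r1 : 'S_n -> 'M[F]_m1)
    (r2 : 'S_n -> 'M[F]_m2) (B : 'M[F]_(m1, m2)) :
  (forall g, g \in Alt 'I_n -> r1 g *m B = B *m r2 g) ->
  (shuffle_in r1 - c%:M) *m B = B *m (shuffle_in r2 - c%:M).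
Proof.
move=> eqB; rewrite mulmxBl mulmxBr scalar_mxC; congr (_ - _).
have /= := @shuffle_in_inter _ _ _ _ r1 r2 1%:M B B 1%:M.
by rewrite !mul1mx !mulmx1; apply=> g gA; rewrite mul1mx mulmx1 eqB.
Qed.

Lemma shuffle_in_sub (c : F) m (r : 'S_n -> 'M[F]_m) p (U : 'M[F]_(p, m)) :
  (forall g, g \in Alt 'I_n -> (U *m r g <= U)%MS) ->
  (U *m (shuffle_in r - c%:M) <= U)%MS.
Proof.
move=> stU; rewrite mulmxBr addmx_sub ?eqmx_opp ?mul_mx_scalar ?scalemx_sub //.
rewrite /shuffle_in mulmxDr addmx_sub ?stU ?group1 // mulmx_sumr.
apply: summx_sub => i lti; rewrite mulmx_sumr; apply: summx_sub => j /eqP jn.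
rewrite mulmx_sumr; apply: summx_sub => k /eqP kn.
have ij : i != j by rewrite -val_eqE /=; lia.
have ik : i != k by rewrite -val_eqE /=; lia.
by rewrite mulmxDr addmx_sub ?stU ?cycle3_Alt.
Qed.

Lemma shuffle_in_submod (G : {group 'S_n}) m (r : mx_representation F G m)
    (U : 'M[F]_m) (modU : mxmodule r U) (c : F) : Alt 'I_n \subset G ->
  \rank (U *m (shuffle_in r - c%:M)) =
  \rank (shuffle_in (submod_repr modU) - c%:M).
Proof.
move=> sAG; rewrite -(eqmxMr _ (val_submod1 U)).
have <- : (shuffle_in (submod_repr modU) - c%:M) *m val_submod 1%:M =
          val_submod (U := U) 1%:M *m (shuffle_in r - c%:M).
  apply: shuffle_in_inter_sub => g gA.
  by rewrite -val_submodE -[submod_repr modU g]mul1mx val_submodJ ?(subsetP sAG).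
by rewrite mxrankMfree // /row_free val_submod1.
Qed.

(** The transposition of [i] and [j] inside [jm r j] cancels against the last factor and gives the
    identity; each [l < i] yields the two 3-cycles. *)
Lemma shuffle_in_pair m (r : mx_representation F 'Sym_('I_n) m) i j :
  j = i.+1 :> nat -> j.+1 = n ->
  shuffle_in r = (jm r i + jm r j) *m r (tperm i j).
Proof.
move=> ij jn; have rM g h : r g *m r h = r (g * h)%g by rewrite repr_mxM ?inE.
have ji : (i < j)%N by rewrite ij.
have nij : i != j by rewrite -val_eqE /= ij; lia.
have jm_j : jm r j = r (tperm i j) + \sum_(l < n | (l < i)%N) r (tperm l j).
  rewrite /jm (bigD1 i) //=; congr (_ + _); apply: eq_bigl => l.
  by rewrite -val_eqE /=; lia.
rewrite jm_j /shuffle_in /jm addrCA mulmxDl rM tperm2; congr (_ + _).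
rewrite -big_split mulmx_suml /=; apply: eq_big => [l|l ltl]; first by lia.
rewrite (big_pred1 i) => [|l']; last by rewrite /= -val_eqE /=; lia.
rewrite (big_pred1 j) => [|l']; last by rewrite /= -val_eqE /=; lia.
have li : l != i by rewrite -val_eqE /=; lia.
have lj : l != j by rewrite -val_eqE /=; lia.
have tlj : (tperm l i * tperm i j)%g = cycle3 l j i.
  by rewrite /cycle3 [RHS]conjgC tpermJ tpermL tpermD // eq_sym.
have tli : (tperm l j * tperm i j)%g = cycle3 l i j.
  by rewrite /cycle3 [RHS]conjgC tpermJ tpermL tpermD ?[tperm j i]tpermC // eq_sym.
by rewrite mulmxDl !rM tlj tli addrC.
Qed.

(** The corrections -1 and +1 of the two exchange relations cancel in the sum. *)
Lemma shuffle_in_comm m (r : mx_representation F 'Sym_('I_n) m) i j :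
  j = i.+1 :> nat -> j.+1 = n ->
  r (tperm i j) *m shuffle_in r = shuffle_in r *m r (tperm i j).
Proof.
move=> ij jn; rewrite (shuffle_in_pair r ij jn) mulmxA; congr (_ *m _).
have pal := repr_palindromic r.
by rewrite mulmxDr jm_mul_swap // jm_mul_swap' // mulmxDl addrACA addNr addr0 addrC.
Qed.

(* The translate of the row space of B by the odd permutation s is again stable
   under the alternating group, and both together are stable under the symmetric
   group; the shuffle commutes with s, so that it acts alike on both. *)
Lemma half_rank m d (r : mx_representation F 'Sym_('I_n) m)
    (rD : mx_representation F 'Alt_('I_n) d) (B : 'M[F]_(d, m)) i j :
  j = i.+1 :> nat -> j.+1 = n ->
  mx_irreducible r -> (0 < d)%N -> row_free B ->
  (forall g, g \in Alt 'I_n -> rD g *m B = B *m r g) ->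
  (m <= d + d)%N /\
  (m = (d + d)%N -> forall c : F,
    \rank (shuffle_in r - c%:M) = (2 * \rank (shuffle_in rD - c%:M)%R)%N).
Proof.
move=> ij jn /mx_irrP[_ irr_r] d_gt0 freeB inter.
set s := tperm i j; have nij : i != j by rewrite -val_eqE /= ij; lia.
have rM g h : r g *m r h = r (g * h)%g by rewrite repr_mxM ?inE.
have odd_s : odd_perm s by rewrite odd_tperm.
have sub_even g : ~~ odd_perm g -> (B *m r g <= B)%MS.
  by move=> eg; rewrite -inter ?Alt_even // submxMl.
have modV : mxmodule r (B + B *m r s)%MS.
  apply/mxmoduleP=> g _; rewrite addsmxMr addsmx_sub -mulmxA rM.
  have [og|eg] := boolP (odd_perm g); apply/andP; split.
  - rewrite -[g](mulgKV s) tpermV -rM mulmxA (submx_trans _ (addsmxSr _ _)) //.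
    by apply/submxMr/sub_even; rewrite odd_permM og odd_s.
  - by rewrite (submx_trans (sub_even _ _)) ?addsmxSl // odd_permM og odd_s.
  - by rewrite (submx_trans (sub_even _ _)) ?addsmxSl.
  - rewrite -[(s * g)%g](mulgKV s) tpermV -rM mulmxA (submx_trans _ (addsmxSr _ _)) //.
    by apply/submxMr/sub_even; rewrite !odd_permM (negPf eg) odd_s.
have nzV : (B + B *m r s)%MS != 0.
  rewrite -mxrank_eq0 -lt0n; apply: leq_trans (mxrankS (addsmxSl _ _)).
  by rewrite (eqP freeB).
have fullV := irr_r _ modV nzV.
pose B' := col_mx B (B *m r s).
have fullB' : row_full B' by rewrite /row_full -addsmxE.
split; first by rewrite -(eqP fullB') rank_leq_row.
move=> def_m c; have freeB' : row_free B' by rewrite /row_free (eqP fullB') def_m.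
have eqB : (shuffle_in rD - c%:M) *m B = B *m (shuffle_in r - c%:M).
  exact: shuffle_in_inter_sub.
(* In the basis formed by [B] and its translate the shuffle is block diagonal, with the same block
   twice. *)
have eqB' : block_mx (shuffle_in rD - c%:M) 0 0 (shuffle_in rD - c%:M) *m B' =
            B' *m (shuffle_in r - c%:M).
  rewrite mul_block_col !mul0mx addr0 add0r mul_col_mx; congr col_mx => //.
  rewrite mulmxA eqB -!mulmxA; congr (_ *m _).
  by rewrite mulmxBr mulmxBl (shuffle_in_comm r ij jn) scalar_mxC.
rewrite -(eqmxMfull _ fullB') -eqB' mxrankMfree //.
by rewrite rank_diag_block_mx mul2n addnn.
Qed.

(** The component is a direct sum of isomorphic simple modules, each stable under the shuffle with
    the same rank. Over a closed field of characteristic zero their number is the degree. *)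
Lemma irr_component_rank (sG : irrType F 'Alt_('I_n)) (D : sG) (c : F) :
  \rank (D *m (shuffle_op F n - c%:M)) =
  (irr_degree D * \rank (shuffle_in (irr_repr D) - c%:M)%R)%N /\
  \rank D = (irr_degree D * irr_degree D)%N.
Proof.
have F'G : ([pchar F]^'.-group 'Alt_('I_n))%g.
  by apply/pgroupP=> p _ _; rewrite inE /= pchar_num.
have splitG : group_splitting_field F 'Alt_('I_n) := @group_closure_closed_field F _ _.
have simU := socle_simple D; set U := socle_base D in simU.
have [I W S0 simW defV dxV] := component_mx_semisimple simU.
have rankU_gt0 : (0 < \rank U)%N by rewrite lt0n mxrank_eq0; case simU.
have isoW x : mx_iso (regular_repr F 'Alt_('I_n)) U (W x).
  by apply: component_mx_iso; rewrite ?simU // -defV (sumsmx_sup x).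
set Q := shuffle_op F n - c%:M.
have rankW x : \rank (W x *m Q) = \rank (U *m Q).
  have [f injf /hom_mxP homf defW] := isoW x.
  rewrite -(eqmxMr _ defW) -mulmxA.
  have -> : U *m (f *m Q) = U *m Q *m f.
    rewrite mulmxA /Q shuffle_in_op mulmxBr mulmxBr mulmxBl.
    rewrite mul_mx_scalar mul_mx_scalar scalemxAl; congr (_ - _).
    have /= := @shuffle_in_inter _ _ _ _ (regular_repr F 'Alt_('I_n))
      (regular_repr F 'Alt_('I_n)) (U *m f) 1%:M U f.
    by rewrite !mulmx1; apply=> g gA; rewrite mulmx1 -homf.
  by apply: mxrankMfree; rewrite row_free_unit.
have rankI : \rank (component_mx (regular_repr F 'Alt_('I_n)) U) = (#|I| * \rank U)%N.
  rewrite -defV (mxdirectP dxV) /= -sum_nat_const.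
  by apply: eq_bigr => x _; apply/esym/mxrank_iso.
have cardI : #|I| = irr_degree D.
  by rewrite -(irr_mx_mult_pchar F'G splitG D) /socle_mult [X in (X %/ _)%N]rankI mulnK.
split; last by rewrite [LHS]rankI cardI.
rewrite [X in (X * _)%N]/irr_degree -/U.
have -> : \rank (shuffle_in (irr_repr D) - c%:M) = \rank (U *m Q).
  by rewrite /Q shuffle_in_op (shuffle_in_submod (socle_module D)).
have stQ x : (W x *m Q <= W x)%MS.
  rewrite /Q shuffle_in_op; apply: shuffle_in_sub => g gA.
  by have /mxmoduleP := mxsimple_module (simW x); apply.
have dxQ : mxdirect (\sum_x W x *m Q)%MS.
  apply/mxdirect_sumsP=> x _; apply/eqP; rewrite -submx0.
  rewrite -[X in (_ <= X)%MS](mxdirect_sumsP dxV x isT); apply: capmxS => //.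
  by apply/sumsmx_subP=> y yx; apply: (submx_trans (stQ y)); apply: (sumsmx_sup y).
have -> : \rank (D *m Q) = \rank (\sum_x W x *m Q)%MS.
  by rewrite -(sumsmxMr _ _ Q) (eqmxMr Q defV).
rewrite (mxdirectP dxQ) /= (eq_bigr (fun=> \rank (U *m Q))) => [|x _]; last exact: rankW.
by rewrite sum_nat_const cardI.
Qed.

(** Rank and nullity on the direct sum of two stable components, in additive form to avoid truncated
    subtraction. *)
Lemma irr_components_rank (sG : irrType F 'Alt_('I_n)) (Dp Dm : sG) (c : F) :
  Dp != Dm ->
  (\rank (eigenspace (shuffle_op F n) c :&: (Dp + Dm))%MS +
    (irr_degree Dp * \rank (shuffle_in (irr_repr Dp) - c%:M)%R +
     irr_degree Dm * \rank (shuffle_in (irr_repr Dm) - c%:M)%R))%N =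
  (irr_degree Dp * irr_degree Dp + irr_degree Dm * irr_degree Dm)%N.
Proof.
move=> nD; have [<- rDp] := irr_component_rank Dp c.
have [<- rDm] := irr_component_rank Dm c; rewrite -rDp -rDm.
have dis : (Dp :&: Dm)%MS = 0.
  apply: component_mx_disjoint (socle_simple _) (socle_simple _) _.
  by apply: contra nD => /eqP eqD; apply/eqP/val_inj.
set Q := shuffle_op F n - c%:M.
have stQ (D : sG) : (D *m Q <= D)%MS.
  rewrite /Q shuffle_in_op; apply: shuffle_in_sub => g gA.
  by have /mxmoduleP := component_mx_module (regular_repr F 'Alt_('I_n)) (socle_base D); apply.
have disQ : (Dp *m Q :&: Dm *m Q)%MS = 0.
  by apply/eqP; rewrite -submx0 -dis capmxS.
rewrite -(mxrank_disjoint_sum dis) -(mxrank_disjoint_sum disQ) -addsmxMr.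
by rewrite addnC (capmxC (eigenspace _ c)) mxrank_mul_ker.
Qed.

End Shuffle.

(** * The two halves of the Specht module and the multiplicities *)

Section AlternatingHalves.
Variables (F : numClosedFieldType) (n : nat) (la : seq nat).
Variables (sG : irrType F 'Alt_('I_n)) (Dp Dm : sG).
Hypotheses (la_n : is_partition n la) (D_la : alternating_pair la Dp Dm).

Local Notation rho := (regular_repr F 'Sym_('I_n)).
Local Notation W := (cyclic_mx rho (young_symmetrizer F n la)).

Lemma alternating_pair_degree : #|Std n la| = (irr_degree Dp + irr_degree Dm)%N.
Proof.
have [_ /mxrank_rsim/= <-] := D_la.
rewrite (young_symmetrizer_ysym la_n) (Std_stdtabs la_n).
by rewrite specht_rank ?stdtab_reading_tab //; apply: reading_tab_row_sorted.
Qed.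

Lemma specht_shuffle_rank (i j : 'I_n) (x : int) : j = i.+1 :> nat -> j.+1 = n ->
  \rank (shuffle_in (specht_repr F n la) - (x%:~R)%:M) =
  #|[set T in Std n la | tab_eigenvalue i j T != x]|.
Proof.
move=> ij jn; rewrite -shuffle_in_submod ?Alt_subset //.
rewrite (young_symmetrizer_ysym la_n) (Std_stdtabs la_n).
rewrite (shuffle_in_pair rho ij jn) -(pair_rank F) //.
  exact: stdtab_reading_tab.
exact: reading_tab_row_sorted.
Qed.

(** [half_rank] bounds the dimension of the Specht module by twice the degree of each half. Since
    the degrees add up to it, both bounds are attained. *)
Lemma alternating_pair_halves (i j : 'I_n) : j = i.+1 :> nat -> j.+1 = n ->
  irr_degree Dp = irr_degree Dm /\
  forall (D : sG) (c : F), D \in [:: Dp; Dm] ->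
    \rank (shuffle_in (specht_repr F n la) - c%:M) =
    (2 * \rank (shuffle_in (irr_repr D) - c%:M)%R)%N.
Proof.
move=> ij jn; have [_ /mx_rsim_sym[/= C eqd freeC interC]] := D_la.
have irrS : mx_irreducible (specht_repr F n la).
  apply/submod_mx_irr; rewrite (young_symmetrizer_ysym la_n).
  apply: specht_simple; first exact: stdtab_reading_tab.
  exact: reading_tab_row_sorted.
pose Cp := usubmx C; pose Cm := dsubmx C.
have defC : C = col_mx Cp Cm by rewrite vsubmxK.
have inter g : g \in Alt 'I_n ->
    irr_repr Dp g *m Cp = Cp *m specht_repr F n la g /\
    irr_repr Dm g *m Cm = Cm *m specht_repr F n la g.
  move=> gA; have := interC g gA; rewrite /= defC mul_block_col !mul0mx addr0 add0r.
  by rewrite mul_col_mx => /eq_col_mx[].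
have [freep freem] : row_free Cp /\ row_free Cm.
  have := eqP freeC; rewrite {1}defC -addsmxE => rC.
  have := mxrank_adds_leqif Cp Cm; rewrite rC => -[le _].
  have lep := rank_leq_row Cp; have lem := rank_leq_row Cm.
  by split; apply/eqP; lia.
have [lep rkp] := half_rank ij jn irrS (irr_degree_gt0 Dp) freep (fun g gA => (inter g gA).1).
have [lem rkm] := half_rank ij jn irrS (irr_degree_gt0 Dm) freem (fun g gA => (inter g gA).2).
have eqpm : irr_degree Dp = irr_degree Dm.
  by move: eqd lep lem; lia.
split=> // D c; rewrite !inE => /orP[] /eqP ->.
  by apply: rkp; move: eqd eqpm; lia.
by apply: rkm; move: eqd eqpm; lia.
Qed.

Lemma alternating_pair_multiplicity (T : tableau n) (x : int) :
  self_conjugate la -> T \in UStd n la -> x \in eigenvalues_of T ->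
  \rank (eigenspace (shuffle_op F n) x%:~R :&: (Dp + Dm))%MS =
    ((\sum_(S in UStd n la) count_mem x (eigenvalues_of S)) * #|Std n la|)%N.
Proof.
move=> la_sc TU xT; have n_gt3 := eigenvalues_of_n_ge4 la_n la_sc TU xT.
have lti : (n.-2 < n)%N by lia.
have ltj : (n.-1 < n)%N by lia.
pose i := Ordinal lti; pose j := Ordinal ltj.
have ij : j = i.+1 :> nat by rewrite /=; lia.
have jn : j.+1 = n by rewrite /=; lia.
have [eqd rk] := alternating_pair_halves ij jn.
have [nD _] := D_la.
have rankE := irr_components_rank x%:~R nD.
have rkp := rk Dp x%:~R (mem_head Dp [:: Dm]).
have rkm := rk Dm x%:~R (mem_last Dp [:: Dm]).
have cardE : (#|[set S in Std n la | tab_eigenvalue i j S == x]| +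
              \rank (shuffle_in (specht_repr F n la) - (x%:~R)%:M)%R = #|Std n la|)%N.
  have cardID (A : {set tableau n}) (p : pred (tableau n)) :
      (#|[set S in A | p S]| + #|[set S in A | ~~ p S]| = #|A|)%N.
    by rewrite -!sum1dep_card -sum1_card [RHS](bigID p).
  by rewrite (specht_shuffle_rank x ij jn) cardID.
(* [A] and [B] count the tableaux with value [x] in [Std] and in [UStd]; [f] is the size of [Std],
   the [d] are degrees, the [r] ranks, and [e] is the multiplicity. *)
have arith (A B f dp dm rp rm rs e : nat) : dp = dm -> rs = (2 * rp)%N ->
    rs = (2 * rm)%N -> (A + rs = f)%N -> f = (dp + dm)%N -> A = (2 * B)%N ->
    (e + (dp * rp + dm * rm) = dp * dp + dm * dm)%N -> e = (B * f)%N.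
  move=> <- -> eqr sumA eqf eqA eq_e; rewrite eqf in sumA *.
  have -> : B = (dp - rp)%N by lia.
  have le_rd : (rp <= dp)%N by lia.
  have eq_rm : rm = rp by lia.
  move: eq_e; rewrite eq_rm -(subnKC le_rd); nia.
rewrite -(card_UStd_eigenvalue la_n la_sc ij jn n_gt3).
apply: arith eqd rkp rkm cardE alternating_pair_degree _ rankE.
exact: card_Std_eigenvalue.
Qed.

End AlternatingHalves.

Theorem theorem2p5 (R : realType) (n : nat) (la : seq nat)
    (sG : irrType R[i] 'Alt_('I_n)) (Dp Dm : sG)
    (la_n : is_partition n la) (la_sc : self_conjugate la)
    (D_la : alternating_pair la Dp Dm) :
  let P := shuffle_op R[i] n in
  [/\ forall T : tableau n, T \in UStd n la ->
        let a_n := content T n in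
        let a_n1 := content T n.-1 in
        [/\ a_n = a_n1 + 1 -> eigenvalue P (2 * a_n - 1)%:~R,
            a_n = a_n1 - 1 -> eigenvalue P (- (2 * a_n + 1))%:~R &
            a_n <> a_n1 + 1 -> a_n <> a_n1 - 1 -> a_n1 < a_n ->
              eigenvalue P (a_n + a_n1)%:~R /\
              eigenvalue P (- (a_n + a_n1))%:~R],
      #|Std n la| = (irr_degree Dp + irr_degree Dm)%N &
      forall (T : tableau n) (x : int),
        T \in UStd n la -> x \in eigenvalues_of T ->
        \rank (eigenspace P x%:~R :&: (Dp + Dm))%MS =
          ((\sum_(S in UStd n la) count_mem x (eigenvalues_of S)) *
             #|Std n la|)%N].
Proof.
move=> P.
have mult T x : T \in UStd n la -> x \in eigenvalues_of T ->
    \rank (eigenspace P x%:~R :&: (Dp + Dm))%MS =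
      ((\sum_(S in UStd n la) count_mem x (eigenvalues_of S)) * #|Std n la|)%N.
  exact: (alternating_pair_multiplicity la_n D_la la_sc).
(* A listed value has positive multiplicity, as [T] itself contributes to both factors. *)
have ev T x : T \in UStd n la -> x \in eigenvalues_of T -> eigenvalue P x%:~R.
  move=> TU xT; have := mult T x TU xT; apply: contra_eqN => /eqP eig0.
  rewrite eig0 cap0mx mxrank0 eq_sym -lt0n muln_gt0; apply/andP; split.
    by rewrite (bigD1 T) //= addn_gt0 -has_count has_pred1 xT.
  by apply/card_gt0P; exists T; apply: UStd_Std.
split; [|exact: (alternating_pair_degree la_n D_la)|exact: mult].
move=> T TU a b; have evT := ev T _ TU; split.
- by move=> ab; apply: evT; rewrite /eigenvalues_of -/a -/b ab eqxx inE.
- move=> ab; apply: evT; rewrite /eigenvalues_of -/a -/b ab eqxx.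
  by rewrite (_ : (b - 1 == b + 1) = false) ?inE ?eqxx //; lia.
move=> /eqP/negPf n1 /eqP/negPf n2 ltba.
split; apply: evT; rewrite /eigenvalues_of -/a -/b n1 n2 ltba !inE eqxx ?orbT //.
Qed.
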